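(* The multiplication in $A$ induces a bijective linear map $m:\bigotimes_{\mu\in\overline{\mathbb R}}A_{[\mu]}\to A$.
   Context: Let $\Gamma$ be a discrete submonoid of the half-plane $\{(r,d)\in\mathbb R^2: r>0\text{ or }(r=0\text{ and }d\ge0)\}$ and let $A=\bigoplus_{\gamma\in\Gamma}A^\gamma$ be a $\Gamma$-graded bialgebra over a field $k$ which is connected ($A^0=k$). Write $|a|=\gamma$ for $a\in A^\gamma$. For homogeneous $a$, $L(a)$ (resp. $R(a)$) is the set of $\beta$ (resp. $\gamma$) such that $\Delta(a)$ has a nonzero component in $A^\beta\otimes A^\gamma$. Let $\overline{\mathbb R}=\mathbb R\cup\{\infty\}$, $\infty$ larger than all reals; $\Gamma_\infty=\{(r,d)\in\Gamma: r=0\}$, $\Gamma_\mu=\{(r,d)\in\Gamma: d=\mu r\}$ for $\mu\in\mathbb R$, $\Gamma_{\le\mu}=\bigcup_{\nu\le\mu}\Gamma_\nu$. A homogeneous $a$ is semistable of slope $\mu$ if $|a|\in\Gamma_\mu$ and $L(a)\subset\Gamma_{\le\mu}$. $A_{[\mu]}$ denotes the span of the semistable elements of slope $\mu$. For a finite $M\subset\overline{\mathbb R}$, $\bigotimes_{\mu\in M}A_{[\mu]}$ is the tensor product taken in decreasing order of $\mu$; for $M_1\subset M_2$ there is an injection inserting $1$ in the missing factors, and $\bigotimes_{\mu\in\overline{\mathbb R}}A_{[\mu]}$ is the inductive limit over finite $M$. The map $m$ sends $a_1\otimes\dots\otimes a_p$ to $a_1\cdots a_p$. *)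

(* Defs.v *)
(* Tensor products over the field k are modelled by
   representatives (finite lists of pure tensors) modulo the relation
   "all k-multilinear forms agree". *)
From HB Require Import structures.
From mathcomp Require Import all_boot all_order all_algebra.
From mathcomp Require Import reals.
Set Implicit Arguments. Unset Strict Implicit. Unset Printing Implicit Defensive.
Import Order.TTheory GRing.Theory Num.Theory.
Local Open Scope ring_scope.

Section GammaDefs.
Variable R : realType.

Definition half_plane (g : R * R) : Prop := 0 < g.1 \/ (g.1 = 0 /\ 0 <= g.2).

Definition discrete_submonoid_half_plane (Gamma : R * R -> Prop) : Prop :=
  [/\ Gamma (0, 0),
      (forall g h, Gamma g -> Gamma h -> Gamma (g.1 + h.1, g.2 + h.2)),
      (forall g, Gamma g -> half_plane g) &
      (forall g, Gamma g -> exists2 e : R, 0 < e &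
         forall h, Gamma h -> `|h.1 - g.1| < e -> `|h.2 - g.2| < e -> h = g)].

(* extended slopes: [Some mu] is the real mu, [None] is infinity *)
Definition slope_lt (nu mu : option R) : bool :=
  match nu, mu with
  | Some n, Some m => n < m
  | Some _, None => true
  | None, _ => false
  end.

Definition slope_le (nu mu : option R) : bool :=
  match nu, mu with
  | Some n, Some m => n <= m
  | _, None => true
  | None, Some _ => false
  end.

Definition Gamma_slope (Gamma : R * R -> Prop) (mu : option R) (g : R * R) : Prop :=
  Gamma g /\ match mu with None => g.1 = 0 | Some m => g.2 = m * g.1 end.

Definition Gamma_le (Gamma : R * R -> Prop) (mu : option R) (g : R * R) : Prop :=
  exists nu, slope_le nu mu /\ Gamma_slope Gamma nu g.

End GammaDefs.

Section Tensors.
Variables (k : fieldType) (A : algType k).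

Definition upd (p : nat) (u : {ffun 'I_p -> A}) (i : 'I_p) (x : A) : {ffun 'I_p -> A} :=
  [ffun j => if j == i then x else u j].

Definition multilinear (p : nat) (f : {ffun 'I_p -> A} -> k) : Prop :=
  forall (u : {ffun 'I_p -> A}) (i : 'I_p) (c : k) (x y : A),
    f (upd u i (c *: x + y)) = c * f (upd u i x) + f (upd u i y).

(* equality of the elements of the p-fold tensor power of A over k
   represented by the lists of pure tensors s and t *)
Definition teq (p : nat) (s t : seq {ffun 'I_p -> A}) : Prop :=
  forall f : {ffun 'I_p -> A} -> k, multilinear f ->
    \sum_(u <- s) f u = \sum_(u <- t) f u.

Definition t2 (x : A * A) : {ffun 'I_2 -> A} :=
  [ffun i : 'I_2 => if val i == 0%N then x.1 else x.2].

Definition t3 (x y z : A) : {ffun 'I_3 -> A} :=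
  [ffun i : 'I_3 => if val i == 0%N then x else if val i == 1%N then y else z].

Definition teq2 (s t : seq (A * A)) : Prop := teq (map t2 s) (map t2 t).

End Tensors.

Section Bialgebra.
Variables (R : realType) (k : fieldType) (A : algType k).
Variable Gamma : R * R -> Prop.
(* pi g : the projection of A onto its homogeneous component A^g *)
Variable pi : R * R -> A -> A.
Variable eps : A -> k.
Variable Delta : A -> seq (A * A).

Definition gplus (g h : R * R) : R * R := (g.1 + h.1, g.2 + h.2).

Definition homogeneous (g : R * R) (a : A) : Prop := pi g a = a.

Definition tcomp (b c : R * R) (s : seq (A * A)) : seq (A * A) :=
  [seq (pi b x.1, pi c x.2) | x <- s].

Definition is_Gamma_graded_connected_bialgebra : Prop :=
  (* A = (+)_{g in Gamma} A^g, via the projections pi g *)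
  (forall g (c : k) (a b : A), pi g (c *: a + b) = c *: pi g a + pi g b) /\
  (forall g a, pi g (pi g a) = pi g a) /\
  (forall g h a, g != h -> pi g (pi h a) = 0) /\
  (forall g a, pi g a != 0 -> Gamma g) /\
  (forall a, exists s : seq (R * R),
      [/\ uniq s, (forall g, pi g a != 0 -> g \in s) & a = \sum_(g <- s) pi g a]) /\
  (forall g h a b, homogeneous g a -> homogeneous h b -> homogeneous (gplus g h) (a * b)) /\
  homogeneous (0, 0) 1 /\
  (forall a, homogeneous (0, 0) a -> exists c : k, a = c%:A) /\
  (forall (c : k) (a b : A), eps (c *: a + b) = c * eps a + eps b) /\
  (forall a b, eps (a * b) = eps a * eps b) /\
  eps 1 = 1 /\
  (forall g a, homogeneous g a -> g != (0, 0) -> eps a = 0) /\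
  (forall (c : k) (a b : A),
      teq2 (Delta (c *: a + b)) ([seq (c *: x.1, x.2) | x <- Delta a] ++ Delta b)) /\
  (forall a b, teq2 (Delta (a * b))
                    [seq (x.1 * y.1, x.2 * y.2) | x <- Delta a, y <- Delta b]) /\
  teq2 (Delta 1) [:: (1, 1)] /\
  (forall g a b c, homogeneous g a -> gplus b c != g -> teq2 (tcomp b c (Delta a)) [::]) /\
  (forall a, teq [seq t3 y.1 y.2 x.2 | x <- Delta a, y <- Delta x.1]
                 [seq t3 x.1 y.1 y.2 | x <- Delta a, y <- Delta x.2]) /\
  (forall a, \sum_(x <- Delta a) eps x.1 *: x.2 = a) /\
  (forall a, \sum_(x <- Delta a) eps x.2 *: x.1 = a).

Definition Lset (a : A) (b : R * R) : Prop :=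
  exists c : R * R, ~ teq2 (tcomp b c (Delta a)) [::].

Definition semistable (mu : option R) (a : A) : Prop :=
  exists g, [/\ homogeneous g a, Gamma_slope Gamma mu g &
                forall b, Lset a b -> Gamma_le Gamma mu b].

Definition in_Amu (mu : option R) (x : A) : Prop :=
  exists s : seq (k * A),
    (forall y, y \in s -> semistable mu y.2) /\ x = \sum_(y <- s) y.1 *: y.2.

Definition decreasing_slopes (ms : seq (option R)) : bool :=
  sorted (fun x y => slope_lt y x) ms.

(* representatives of elements of (x)_{mu in ms} A_[mu] *)
Definition in_tensor_Amu (ms : seq (option R)) (s : seq {ffun 'I_(size ms) -> A}) : Prop :=
  forall u, u \in s -> forall i : 'I_(size ms), in_Amu (nth None ms i) (u i).

Definition mult_map (p : nat) (s : seq {ffun 'I_p -> A}) : A :=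
  \sum_(u <- s) \prod_(i < p) u i.

(* m : (x)_{mu in Rbar} A_[mu] -> A is bijective: injective on each finite
   stage of the inductive limit, and jointly surjective. *)
Definition mult_bijective : Prop :=
  (forall ms : seq (option R), decreasing_slopes ms ->
     forall s, @in_tensor_Amu ms s -> mult_map s = 0 -> teq s [::])
  /\
  (forall a : A, exists ms : seq (option R), decreasing_slopes ms /\
     exists2 s, @in_tensor_Amu ms s & a = mult_map s).

End Bialgebra.

(* Main.v *)
(** The coproduct separates slopes.  If x is semistable of slope mu and every
    nonzero degree in L(y) has slope < mu, then the degrees in L(xy) have slope
    <= mu, and on the ray of slope mu the component of Delta(xy) in the largest
    degree |x| is exactly x (x) y.

    Injectivity: in a relation sum x_j y_j = 0 with x_j in A_[mu] and y_j of
    slopes < mu, the component of the coproduct in the largest degree of the x_j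
    isolates the terms whose left factor has that degree, so these cancel in
    A (x) A; the slopes are then removed one at a time.

    Surjectivity: for a homogeneous, let b be the element of L(a) of largest
    slope, and the largest one on its ray.  By coassociativity the component of
    Delta(a) in A^b (x) A^(|a|-b) is a sum of x_i (x) y_i with x_i semistable and
    y_i of slopes strictly below that of b; subtracting sum x_i y_i from a kills
    the component at b and creates only smaller ones.  This terminates because a
    lies in the sub-bialgebra of elements whose iterated coproducts have all
    their degrees in a finitely generated submonoid S of the half-plane, and an
    element of S has only finitely many decompositions in S. *)
Require Import Defs.
From HB Require Import structures.
From mathcomp Require Import all_boot all_order all_algebra.
From mathcomp Require Import reals.
From mathcomp Require Import boolp classical_sets.
From mathcomp Require Import ring lra.
Set Implicit Arguments. Unset Strict Implicit. Unset Printing Implicit Defensive.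
Import Order.TTheory GRing.Theory Num.Theory.
Local Open Scope ring_scope.

(** * Linear maps and tensors over a field *)

Section LinearMaps.
Variable k : fieldType.

Definition lin (U V : lmodType k) (f : U -> V) : Prop :=
  forall c x y, f (c *: x + y) = c *: f x + f y.

Section Rules.
Variables U V W : lmodType k.
Implicit Types f g : U -> V.

Lemma lin0 f : lin f -> f 0 = 0.
Proof.
move=> lf; have := lf 1 0 0; rewrite !scale1r addr0 => /eqP.
by rewrite -subr_eq0 opprD addNKr oppr_eq0 => /eqP.
Qed.

Lemma linD f : lin f -> forall x y, f (x + y) = f x + f y.
Proof. by move=> lf x y; have := lf 1 x y; rewrite !scale1r. Qed.

Lemma linZ f : lin f -> forall c x, f (c *: x) = c *: f x.
Proof. by move=> lf c x; have := lf c x 0; rewrite !addr0 (lin0 lf) addr0. Qed.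

Lemma linB f : lin f -> forall x y, f (x - y) = f x - f y.
Proof. by move=> lf x y; rewrite (linD lf) -scaleN1r (linZ lf) scaleN1r. Qed.

Lemma lin_sum f : lin f -> forall (I : Type) (r : seq I) (P : pred I) (F : I -> U),
  f (\sum_(i <- r | P i) F i) = \sum_(i <- r | P i) f (F i).
Proof. by move=> lf I r P F; rewrite (big_morph f (linD lf) (lin0 lf)). Qed.

Lemma lin_id : lin (fun x : U => x).
Proof. by []. Qed.

Lemma lin_comp (h : V -> W) f : lin h -> lin f -> lin (fun x => h (f x)).
Proof. by move=> lh lf c x y; rewrite lf lh. Qed.

Lemma lin_cst0 : lin (fun _ : U => 0 : V).
Proof. by move=> c x y; rewrite scaler0 addr0. Qed.

Lemma lin_scaler c f : lin f -> lin (fun x => c *: f x).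
Proof. by move=> lf d x y; rewrite lf scalerDr !scalerA mulrC. Qed.

Lemma lin_scalel (h : U -> k^o) (y : V) : lin h -> lin (fun x => h x *: y).
Proof. by move=> lh d x z; rewrite lh scalerDl scalerA. Qed.

Lemma lin_add f g : lin f -> lin g -> lin (fun x => f x + g x).
Proof. by move=> lf lg c x y; rewrite lf lg scalerDr addrACA. Qed.

Lemma lin_opp f : lin f -> lin (fun x => - f x).
Proof. by move=> lf c x y; rewrite lf opprD scalerN. Qed.

Lemma lin_big (I : Type) (r : seq I) (F : I -> U -> V) :
  (forall i, lin (F i)) -> lin (fun x => \sum_(i <- r) F i x).
Proof.
move=> lF c x y; rewrite scaler_sumr -big_split; apply: eq_bigr => i _.
exact: lF.
Qed.

End Rules.

Definition bilin (U V W : lmodType k) (F : U -> V -> W) : Prop :=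
  (forall y, lin (fun x => F x y)) /\ (forall x, lin (F x)).

Lemma bilin_l (T U V W : lmodType k) (F : U -> V -> W) (f : T -> U) y :
  bilin F -> lin f -> lin (fun x => F (f x) y).
Proof. by move=> [lF _] lf c u v; rewrite lf (lF y). Qed.

Lemma bilin_r (T U V W : lmodType k) (F : U -> V -> W) (f : T -> V) y :
  bilin F -> lin f -> lin (fun x => F y (f x)).
Proof. by move=> [_ lF] lf c u v; rewrite lf (lF y). Qed.

Lemma lin_mull (T : lmodType k) (A : algType k) (f : T -> A) y :
  lin f -> lin (fun x => y * f x).
Proof. by move=> lf c u v; rewrite lf mulrDr scalerAr. Qed.

Lemma lin_mulr (T : lmodType k) (A : algType k) (f : T -> A) y :
  lin f -> lin (fun x => f x * y).
Proof. by move=> lf c u v; rewrite lf mulrDl scalerAl. Qed.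

(* By Zorn there is a hyperplane avoiding v; the functional is the coordinate
   along v modulo that hyperplane. *)
Lemma exists_functional (V : lmodType k) (v : V) :
  v != 0 -> exists f : V -> k^o, lin f /\ f v = 1.
Proof.
move=> v0.
pose P (W : set V) := [/\ W 0, ~ W v &
  forall c x y, W x -> W y -> W (c *: x + y)].
pose Q (W : set V) := W = set0 \/ P W.
have [|W [QW maxW]] := @Zorn_bigcup V Q.
  move=> F FQ totF.
  have [[X [FX PX]]|noX] := pselect (exists X, F X /\ P X); last first.
    left; apply/seteqP; split => // x [Y FY Yx].
    have [Y0|PY] := FQ _ FY; first by rewrite Y0 in Yx.
    by case: noX; exists Y.
  right; split.
  - by exists X => //; case: PX.
  - move=> [Y FY Yv]; have [Y0|[_ nYv _]] := FQ _ FY; last exact: nYv.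
    by rewrite Y0 in Yv.
  - move=> c x y [Y FY Yx] [Z FZ Zy].
    have [Y0|[_ _ lY]] := FQ _ FY; first by rewrite Y0 in Yx.
    have [Z0|[_ _ lZ]] := FQ _ FZ; first by rewrite Z0 in Zy.
    have [YZ|ZY] := totF _ _ FY FZ.
    + by exists Z => //; apply: lZ => //; apply: YZ.
    + by exists Y => //; apply: lY => //; apply: ZY.
have {}QW : P W.
  case: QW => // W0; exfalso; apply: (maxW [set 0]%classic).
    by rewrite W0 properEneq; split => //; apply/eqP/seteqP => -[_ /(_ 0)]; apply.
  right; split => //.
  - by move=> /= e; rewrite e eqxx in v0.
  - by move=> c x y -> ->; rewrite scaler0 addr0.
case: QW => W0 nWv lW.
have WZ c x : W x -> W (c *: x) by move=> Wx; rewrite -[_ *: _]addr0; apply: lW.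
have WD x y : W x -> W y -> W (x + y) by rewrite -{2}[x]scale1r; apply: lW.
have ex x : exists c : k, W (x - c *: v).
  have [Wx|nWx] := pselect (W x); first by exists 0; rewrite scale0r subr0.
  pose B : set V := [set y | exists c : k, W (y - c *: x)]%classic.
  have WB : (W `<` B)%classic.
    rewrite properEneq; split; last by move=> y Wy; exists 0; rewrite scale0r subr0.
    apply/eqP => e; apply: nWx; rewrite e; exists 1.
    by rewrite scale1r subrr.
  have nQB := maxW _ WB.
  have [c Wc] : B v.
    apply: contrapT => nBv; apply: nQB; right; split => //.
      by exists 0; rewrite scale0r subr0.
    move=> d y z [c1 W1] [c2 W2]; exists (d * c1 + c2).
    have -> : d *: y + z - (d * c1 + c2) *: x = d *: (y - c1 *: x) + (z - c2 *: x).
      by rewrite scalerBr scalerDl scalerA opprD addrACA.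
    exact: lW.
  have c0 : c != 0 by apply/eqP => c0; apply: nWv; rewrite c0 scale0r subr0 in Wc.
  exists c^-1; have := WZ (- c^-1) _ Wc.
  by rewrite scalerBr scalerA mulNr mulVf // scaleNr scaleN1r opprK addrC.
pose f x : k^o := projT1 (cid (ex x)).
have fP x : W (x - f x *: v) by rewrite /f; case: cid.
have fu x c : W (x - c *: v) -> f x = c.
  move=> Wc; apply/eqP; rewrite -subr_eq0; apply/negPn/negP => ne.
  apply: nWv; have := lW (-1) _ _ (fP x) Wc.
  rewrite scaleN1r opprB addrA subrK -scalerBl => /(WZ (f x - c)^-1).
  by rewrite scalerA mulVf // scale1r.
exists f; split.
  move=> c x y; apply: fu; have := lW c _ _ (fP x) (fP y).
  by rewrite scalerBr scalerA addrACA -opprD -scalerDl.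
by apply: fu; rewrite scale1r subrr.
Qed.

(** Vector identities can be tested on scalar functionals. This links [teq], defined by [k]-valued
    forms, to maps with values in any space. *)
Lemma functional_sep (V : lmodType k) (v : V) :
  (forall f : V -> k^o, lin f -> f v = 0) -> v = 0.
Proof.
move=> h; apply/eqP/negPn/negP => /exists_functional [f [lf fv]].
by have := h f lf; rewrite fv => /eqP; rewrite oner_eq0.
Qed.

Definition subspace (V : lmodType k) (W : V -> Prop) : Prop :=
  W 0 /\ forall c x y, W x -> W y -> W (c *: x + y).

(** Gaussian elimination on [X]: a vector not yet expanded contributes its residual [y] as a new
    [e i], with a functional [f] such that [f y = 1]. *)
Lemma finite_rank_projector (V : lmodType k) (X : seq V) :
  exists n (phi : nat -> V -> k^o) (e : nat -> V),
    [/\ forall i, lin (phi i),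
        forall W, subspace W -> (forall x, x \in X -> W x) -> forall i, W (e i) &
        forall x, x \in X -> x = \sum_(i < n) phi i x *: e i].
Proof.
elim: X => [|x X [n [phi [e [lphi We eX]]]]].
  exists 0%N, (fun _ _ => 0), (fun _ => 0); split => //.
  - by move=> i; apply: lin_cst0.
  - by move=> W [].
pose y := x - \sum_(i < n) phi i x *: e i.
have [y0|y0] := eqVneq y 0.
  exists n, phi, e; split => //.
    by move=> W sW WX; apply: We => // z zX; apply: WX; rewrite inE zX orbT.
  move=> z; rewrite inE => /orP [/eqP ->|]; last exact: eX.
  by apply/eqP; rewrite -subr_eq0 -/y y0.
have [f [lf fy]] := exists_functional y0.
pose P z := z - \sum_(i < n) phi i z *: e i.
have lP : lin P.
  apply: lin_add; first exact: lin_id.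
  apply: lin_opp; apply: lin_big => i; exact: lin_scalel.
(* Factoring through the residual map [P] makes the new functional vanish on the vectors already
   expanded. *)
pose psi z := f (P z).
have lpsi : lin psi by apply: lin_comp.
exists n.+1, (fun i => if (i == n)%N then psi else phi i),
  (fun i => if (i == n)%N then y else e i); split.
- by move=> i; case: ifP.
- move=> W [W0 lW] WX i.
  have We' j : W (e j).
    by apply: We => // z zX; apply: WX; rewrite inE zX orbT.
  case: ifP => // _; rewrite /y -[x]scale1r; apply: (lW).
    by apply: WX; rewrite inE eqxx.
  rewrite -sumrN; apply: (big_ind W) => // [u v Wu Wv|j _].
    by rewrite -[u]scale1r; apply: lW.
  by rewrite -scaleNr -[_ *: _]addr0; apply: lW.
- have E z : \sum_(i < n.+1) (if (i == n :> nat)%N then psi else phi i) z *: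
      (if (i == n :> nat)%N then y else e i)
      = \sum_(i < n) phi i z *: e i + psi z *: y.
    rewrite big_ord_recr /= eqxx; congr (_ + _); apply: eq_bigr => i _.
    by rewrite (ltn_eqF (ltn_ord i)).
  move=> z; rewrite E inE => /orP [/eqP ->|zX].
    by rewrite /psi -/(P x) -/y fy scale1r addrC subrK.
  have -> : psi z = 0 by rewrite /psi /P -eX // subrr (lin0 lf).
  by rewrite scale0r addr0 -eX.
Qed.

(* A tensor in U (x) V rewritten so that each leg is a contraction of it; hence
   a tensor in (W (x) V) and (U (x) W') has all its legs in W and W'. *)
Lemma minimal_tensor_representative (U V : lmodType k) (t : seq (U * V)) :
  exists n (xs : nat -> U) (ys : nat -> V),
    [/\ forall (Z : lmodType k) (F : U -> V -> Z), bilin F ->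
          \sum_(z <- t) F z.1 z.2 = \sum_(i < n) F (xs i) (ys i),
        forall i, exists2 psi : V -> k^o, lin psi &
          xs i = \sum_(z <- t) psi z.2 *: z.1 &
        forall i, exists2 phi : U -> k^o, lin phi &
          ys i = \sum_(z <- t) phi z.1 *: z.2].
Proof.
have [n [phi [e [lphi _ eX]]]] := finite_rank_projector (map fst t).
pose y i := \sum_(z <- t) phi i z.1 *: z.2.
have [m [psi [f [lpsi Wf fY]]]] := finite_rank_projector [seq y i | i <- iota 0 n].
exists m, (fun l => \sum_(i < n) psi l (y i) *: e i), f; split.
- move=> Z F [Fl Fr].
  transitivity (\sum_(i < n) F (e i) (y i)).
    rewrite (eq_big_seq (fun z => \sum_(i < n) phi i z.1 *: F (e i) z.2)).
      rewrite exchange_big /=; apply: eq_bigr => i _.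
      by rewrite /y (lin_sum (Fr _)); apply: eq_bigr => z _; rewrite (linZ (Fr _)).
    move=> z zt; rewrite {1}(eX z.1); last by apply: map_f.
    by rewrite (lin_sum (Fl _)); apply: eq_bigr => i _; rewrite (linZ (Fl _)).
  rewrite (eq_bigr (fun i : 'I_n => \sum_(l < m) psi l (y i) *: F (e i) (f l))).
    rewrite exchange_big /=; apply: eq_bigr => l _.
    by rewrite (lin_sum (Fl _)); apply: eq_bigr => i _; rewrite (linZ (Fl _)).
  move=> i _; rewrite {1}(fY (y i)); last by apply: map_f; rewrite mem_iota add0n ltn_ord.
  by rewrite (lin_sum (Fr _)); apply: eq_bigr => l _; rewrite (linZ (Fr _)).
- move=> l; exists (psi l) => //.
  rewrite [RHS](eq_big_seq (fun z => \sum_(i < n) (psi l z.2 * phi i z.1) *: e i)).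
    rewrite exchange_big /=; apply: eq_bigr => i _.
    rewrite /y (lin_sum (lpsi _)) scaler_suml; apply: eq_bigr => z _.
    by rewrite (linZ (lpsi _)) [in RHS]mulrC.
  move=> z zt; rewrite {1}(eX z.1); last by apply: map_f.
  by rewrite scaler_sumr; apply: eq_bigr => i _; rewrite scalerA.
- apply: (Wf (fun v => exists2 phi : U -> k^o, lin phi & v = \sum_(z <- t) phi z.1 *: z.2)).
    split.
      exists (fun _ => 0); first exact: lin_cst0.
      by rewrite big1 // => z _; rewrite scale0r.
    move=> c u v [p lp ->] [q lq ->]; exists (fun u => c *: p u + q u).
      by apply: lin_add => //; apply: lin_scaler.
    rewrite scaler_sumr -big_split; apply: eq_bigr => z _ /=.
    by rewrite scalerDl scalerA.
  by move=> x /mapP [i _ ->]; exists (phi i).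
Qed.

End LinearMaps.

(** * Multilinear maps on represented tensors *)

Section TensorForms.
Variables (k : fieldType) (A : algType k).

Definition trilin (V : lmodType k) (F : A -> A -> A -> V) : Prop :=
  [/\ forall y z, lin (fun x => F x y z), forall x z, lin (fun y => F x y z) &
      forall x y, lin (F x y)].

Lemma trilin_1 (T V : lmodType k) (F : A -> A -> A -> V) (f : T -> A) y z :
  trilin F -> lin f -> lin (fun t => F (f t) y z).
Proof. by move=> [h _ _] lf; apply: (lin_comp (h y z)). Qed.

Lemma trilin_2 (T V : lmodType k) (F : A -> A -> A -> V) (f : T -> A) y z :
  trilin F -> lin f -> lin (fun t => F y (f t) z).
Proof. by move=> [_ h _] lf; apply: (lin_comp (h y z)). Qed.

Lemma trilin_3 (T V : lmodType k) (F : A -> A -> A -> V) (f : T -> A) y z :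
  trilin F -> lin f -> lin (fun t => F y z (f t)).
Proof. by move=> [_ _ h] lf; apply: (lin_comp (h y z)). Qed.

(** Composing [F] with an arbitrary functional gives a [k]-valued form to which [teq2] applies;
    [functional_sep] then removes the functional. *)
Lemma teq2_bilin (s t : seq (A * A)) : teq2 s t ->
  forall (V : lmodType k) (F : A -> A -> V), bilin F ->
    \sum_(x <- s) F x.1 x.2 = \sum_(x <- t) F x.1 x.2.
Proof.
move=> st V F [Fl Fr]; apply/eqP; rewrite -subr_eq0; apply/eqP/functional_sep.
move=> f lf; rewrite (linB lf) !(lin_sum lf); apply/eqP; rewrite subr_eq0; apply/eqP.
have mf : multilinear (fun u : {ffun 'I_2 -> A} => f (F (u ord0) (u ord_max))).
  move=> u [[|[|i]] //= hi] c x y; rewrite !ffunE -!val_eqE /=.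
    by rewrite (Fl _ c) lf.
  by rewrite (Fr _ c) lf.
by have := st _ mf; rewrite !big_map; under eq_bigr do rewrite !ffunE /=;
  under [X in _ = X]eq_bigr do rewrite !ffunE /=.
Qed.

Lemma teq3_trilin (I : Type) (s t : seq I) (f1 f2 f3 g1 g2 g3 : I -> A) :
  teq [seq t3 (f1 i) (f2 i) (f3 i) | i <- s] [seq t3 (g1 i) (g2 i) (g3 i) | i <- t] ->
  forall (V : lmodType k) (F : A -> A -> A -> V), trilin F ->
    \sum_(i <- s) F (f1 i) (f2 i) (f3 i) = \sum_(i <- t) F (g1 i) (g2 i) (g3 i).
Proof.
move=> st V F [Fl Fm Fr]; apply/eqP; rewrite -subr_eq0; apply/eqP/functional_sep.
move=> f lf; rewrite (linB lf) !(lin_sum lf); apply/eqP; rewrite subr_eq0; apply/eqP.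
have mf : multilinear (fun u : {ffun 'I_3 -> A} =>
    f (F (u ord0) (u (Ordinal (isT : 1 < 3)%N)) (u ord_max))).
  move=> u [[|[|[|i]]] //= hi] c x y; rewrite !ffunE -!val_eqE /=.
  - by rewrite (Fl _ _ c) lf.
  - by rewrite (Fm _ _ c) lf.
  - by rewrite (Fr _ _ c) lf.
by have := st _ mf; rewrite !big_map; under eq_bigr do rewrite !ffunE /=;
  under [X in _ = X]eq_bigr do rewrite !ffunE /=.
Qed.

Lemma multilinear_t2 (f : {ffun 'I_2 -> A} -> k^o) :
  multilinear f -> bilin (fun u v => f (t2 (u, v))).
Proof.
have E0 (u v x : A) : t2 (x, v) = upd (t2 (u, v)) ord0 x.
  by apply/ffunP => -[[|[|i]] //= hi]; rewrite !ffunE -val_eqE.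
have E1 (u v x : A) : t2 (u, x) = upd (t2 (u, v)) ord_max x.
  by apply/ffunP => -[[|[|i]] //= hi]; rewrite !ffunE -val_eqE.
move=> mf; split=> [v|u] c x y.
  by rewrite (E0 0 v (_ + _)) mf -!E0.
by rewrite (E1 u 0 (_ + _)) mf -!E1.
Qed.

End TensorForms.

(** * Slopes *)

Section SlopeForms.
Variable R : realType.
Implicit Types (mu nu : option R) (b c : R * R).

(* For b nonzero in the half-plane the sign of ell mu b is that of the
   difference between the slope of b and mu. *)
Definition ell mu b : R := match mu with Some m => b.2 - m * b.1 | None => - b.1 end.

Lemma ellD mu b c : ell mu (b + c) = ell mu b + ell mu c.
Proof. by case: mu => [m|] /=; ring. Qed.

Lemma ellB mu b c : ell mu (b - c) = ell mu b - ell mu c.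
Proof. by case: mu => [m|] /=; ring. Qed.

Lemma half_planeD b c : half_plane b -> half_plane c -> half_plane (b + c).
Proof.
rewrite /half_plane; case: b c => [b1 b2] [c1 c2] /= [h|[-> h]] [h'|[-> h']].
- by left; lra.
- by left; lra.
- by left; lra.
- by right; split; lra.
Qed.

Lemma half_plane_total b c : half_plane (b - c) \/ half_plane (c - b).
Proof.
rewrite /half_plane; case: b c => [b1 b2] [c1 c2] /=.
have [h|h|->] := ltgtP b1 c1; [by right; left; lra | by left; left; lra |].
have [h|h] := leP b2 c2; [right | left]; right; split; lra.
Qed.

Lemma half_plane_antisym b : half_plane b -> half_plane (- b) -> b = 0.
Proof.
rewrite /half_plane; case: b => [b1 b2] /= [h|[e h]] [h'|[e' h']]; try by exfalso; lra.
by rewrite e; congr pair; lra.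
Qed.

Lemma pair_neq0 b : b != 0 -> b.1 = 0 -> b.2 != 0.
Proof. by case: b => x y /= h e; apply: contra h => /eqP ->; rewrite e. Qed.

(** At the origin every [ell] vanishes, so strictness rests on [b != 0]; this is why that condition
    recurs in the slope estimates. *)
Lemma ell_lt nu mu b : slope_lt nu mu -> half_plane b -> b != 0 ->
  ell nu b <= 0 -> ell mu b < 0.
Proof.
move=> lt hb b0; case: nu mu lt => [n|] [m|] //= lt.
  case: hb => [hb|[hb hb2]]; first by nra.
  by have := pair_neq0 b0 hb; rewrite hb; lra.
case: hb => [hb|[hb hb2]]; first by lra.
by have := pair_neq0 b0 hb; rewrite hb; lra.
Qed.

Lemma Gamma_leP (Gamma : R * R -> Prop) mu b : Gamma b -> half_plane b ->
  Gamma_le Gamma mu b <-> ell mu b <= 0.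
Proof.
move=> Gb hb; split.
  case=> nu [le [_]]; case: nu mu le => [n|] [m|] //= le; case: hb => [hb|[hb hb2]]; nra.
move=> le; case: hb => [hb|[hb hb2]].
  exists (Some (b.2 / b.1)); split; last by split=> //; rewrite mulfVK // gt_eqF.
  by case: mu le => [m|] //= le; rewrite ler_pdivrMr //; lra.
(* Now [b] is on the vertical axis. For finite [mu] the inequality forces b = 0, which lies on every
   ray, so [mu] itself is a witness. *)
exists mu; split; first by case: (mu) => [m|] /=.
by split=> //; case: mu le => [m|] //=; rewrite hb; lra.
Qed.

Lemma Gamma_slope_ell (Gamma : R * R -> Prop) mu b :
  Gamma_slope Gamma mu b <-> Gamma b /\ ell mu b = 0.
Proof.
by split=> -[Gb h]; split=> //; case: mu h => [m|] /= h; lra.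
Qed.

(** The origin gets slope infinity by convention although it lies on every ray; comparisons of [slp]
    with [ell] therefore assume [b != 0]. *)
Definition slp b : option R := if b.1 == 0 then None else Some (b.2 / b.1).

Lemma ell_slp b : ell (slp b) b = 0.
Proof.
rewrite /slp; case: eqP => [h|/eqP h] /=; first by rewrite h oppr0.
by rewrite mulfVK // subrr.
Qed.

Lemma slp_ltP mu b : half_plane b -> b != 0 -> slope_lt (slp b) mu = (ell mu b < 0).
Proof.
move=> hb b0; rewrite /slp; case: eqP => [h|/eqP h].
  have := pair_neq0 b0 h; case: hb => [|[_]]; first by lra.
  case: mu => [m|] /=; rewrite h; last by lra.
  by move=> ? ?; apply/esym/negbTE; rewrite -leNgt; lra.
have hb1 : 0 < b.1 by case: hb => // -[e]; rewrite e eqxx in h.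
case: mu => [m|] /=; last by apply/esym; lra.
by rewrite ltr_pdivrMr // subr_lt0.
Qed.

Lemma slp_eqP mu b : half_plane b -> b != 0 -> (slp b = mu) <-> (ell mu b = 0).
Proof.
move=> hb b0; split=> [<-|]; first exact: ell_slp.
rewrite /slp; case: eqP => [h|/eqP h].
  have := pair_neq0 b0 h; case: mu => [m|] //=; rewrite h mulr0 subr0.
  by move=> /eqP.
case: mu => [m|] /= e; last by move: h; rewrite -oppr_eq0 e eqxx.
by congr Some; apply: (mulIf h); rewrite mulfVK //; lra.
Qed.

Lemma slope_lt_trans : transitive (fun mu nu => @slope_lt R mu nu).
Proof. by move=> [n|] [m|] [p|] //=; apply: lt_trans. Qed.

Lemma slope_lt_irr mu : slope_lt mu mu = false.
Proof. by case: mu => //= m; rewrite ltxx. Qed.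

Lemma slope_lt_total mu nu : [\/ slope_lt mu nu, mu = nu | slope_lt nu mu].
Proof.
case: mu nu => [m|] [n|] /=; try by [constructor 1 | constructor 2 | constructor 3].
by have [h|h|->] := ltgtP m n; [constructor 1 | constructor 3 | constructor 2].
Qed.

(** [half_plane] is the positive cone of the lexicographic order on the plane, which breaks ties on
    a ray. This order selects the next degree to remove in the surjectivity argument. *)
Definition slope_lex_le b c : Prop :=
  slope_lt (slp b) (slp c) \/ slp b = slp c /\ half_plane (c - b).

Lemma slope_lex_le_trans b c d :
  slope_lex_le b c -> slope_lex_le c d -> slope_lex_le b d.
Proof.
rewrite /slope_lex_le => -[h|[-> h]] [h'|[e h']].
- by left; apply: slope_lt_trans h'.
- by left; rewrite -e.
- by left.
- by right; split=> //; have := half_planeD h' h; rewrite addrA subrK.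
Qed.

Lemma slope_lex_le_total b c : slope_lex_le b c \/ slope_lex_le c b.
Proof.
rewrite /slope_lex_le; have [h|h|h] := slope_lt_total (slp b) (slp c).
- by left; left.
- by rewrite h; have [h'|h'] := half_plane_total b c; [right|left]; right.
- by right; left.
Qed.

Lemma slope_lex_le_antisym b c : slope_lex_le b c -> slope_lex_le c b -> b = c.
Proof.
rewrite /slope_lex_le => -[h|[e h]] [h'|[e' h']].
- by have := slope_lt_trans h h'; rewrite slope_lt_irr.
- by move: h; rewrite e' slope_lt_irr.
- by move: h'; rewrite e slope_lt_irr.
- by apply/eqP; rewrite -subr_eq0 (half_plane_antisym h') // opprB.
Qed.

Lemma exists_max (T : eqType) (r : T -> T -> Prop) (s : seq T) :
  (forall x y z, r x y -> r y z -> r x z) -> (forall x y, r x y \/ r y x) ->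
  s != [::] -> exists2 m, m \in s & forall x, x \in s -> r x m.
Proof.
move=> tr tot; elim: s => // x [|y s] IH _.
  exists x; rewrite ?inE // => z; rewrite inE => /eqP ->.
  by case: (tot x x).
have [//|m ms hm] := IH; have [h|h] := tot x m.
  exists m; first by rewrite inE ms orbT.
  by move=> z; rewrite inE => /orP [/eqP ->|/hm].
exists x; first by rewrite inE eqxx.
move=> z; rewrite inE => /orP [/eqP ->|/hm zm]; first by case: (tot x x).
exact: tr h.
Qed.

End SlopeForms.

(** * The coproduct and its homogeneous components *)

Section GradedBialgebra.
Variables (R : realType) (k : fieldType) (A : algType k).
Variables (Gamma : R * R -> Prop) (pi : R * R -> A -> A) (eps : A -> k).
Variable Delta : A -> seq (A * A).
Hypothesis Gamma_half_plane : forall g, Gamma g -> half_plane g.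
Hypothesis bialgA : is_Gamma_graded_connected_bialgebra Gamma pi eps Delta.
Implicit Types (a x y : A) (b c g h : R * R) (mu nu : option R).

Lemma lin_pi (T : lmodType k) (f : T -> A) g : lin f -> lin (fun t => pi g (f t)).
Proof. by case: bialgA => pl _ lf c x y; rewrite lf pl. Qed.

Lemma piZ g d a : pi g (d *: a) = d *: pi g a.
Proof. by apply: (linZ (lin_pi g (@lin_id _ _))). Qed.

Lemma pi_idem g a : pi g (pi g a) = pi g a.
Proof. by have [_ [h _]] := bialgA; exact: h. Qed.

Lemma pi_orth g h a : g != h -> pi g (pi h a) = 0.
Proof. by have [_ [_ [H _]]] := bialgA; exact: H. Qed.

Lemma pi_out g a : ~ Gamma g -> pi g a = 0.
Proof.
have [_ [_ [_ [H _]]]] := bialgA.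
by move=> nG; apply/eqP/negPn/negP => /H.
Qed.

(** One finite list of degrees serves all of [s], so that sums over the legs of a coproduct can be
    exchanged with sums over degrees. *)
Lemma pi_decompose (s : seq A) : exists D : seq (R * R),
  [/\ uniq D, forall a g, a \in s -> g \notin D -> pi g a = 0 &
      forall a, a \in s -> a = \sum_(g <- D) pi g a].
Proof.
have [_ [_ [_ [_ [H _]]]]] := bialgA.
elim: s => [|x s [D [uD oD eD]]]; first by exists [::].
have [Dx [uDx oDx eDx]] := H x.
have out a g (E : seq (R * R)) : (forall g, pi g a != 0 -> g \in E) ->
    g \notin E -> pi g a = 0.
  by move=> hE gE; apply/eqP/negPn/negP => /hE; rewrite (negbTE gE).
have ext a (E F : seq (R * R)) : uniq E -> uniq F -> {subset E <= F} ->
    (forall g, pi g a != 0 -> g \in E) -> a = \sum_(g <- E) pi g a ->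
    a = \sum_(g <- F) pi g a.
  move=> uE uF sEF hE eE; rewrite {1}eE [RHS](bigID (mem E)) /=.
  rewrite [X in _ + X]big1 ?addr0; last by move=> g; apply: out.
  rewrite -[RHS]big_filter; apply: perm_big; apply: uniq_perm => //.
    exact: filter_uniq.
  by move=> g; rewrite mem_filter; case: (boolP (g \in E)) => // /sEF ->.
have sub1 : {subset Dx <= undup (Dx ++ D)}.
  by move=> g h; rewrite mem_undup mem_cat h.
have sub2 : {subset D <= undup (Dx ++ D)}.
  by move=> g h; rewrite mem_undup mem_cat h orbT.
have oD' a : a \in s -> forall g, pi g a != 0 -> g \in D.
  by move=> aS g; apply: contraNT => gD; rewrite (oD a g).
exists (undup (Dx ++ D)); split; first exact: undup_uniq.
  move=> a g; rewrite inE => /orP [/eqP ->|aS] gD.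
    by apply: (out _ _ Dx) => //; apply: contra gD; apply: sub1.
  by apply: oD => //; apply: contra gD; apply: sub2.
move=> a; rewrite inE => /orP [/eqP ->|aS].
  exact: (ext _ Dx) (undup_uniq _) sub1 oDx eDx.
exact: (ext _ D) (undup_uniq _) sub2 (oD' _ aS) (eD _ aS).
Qed.

Lemma lin_homog_ext (V : lmodType k) (f : A -> V) a : lin f ->
  (forall g, f (pi g a) = 0) -> f a = 0.
Proof.
move=> lf f0; have [D [_ _ /(_ a)]] := pi_decompose [:: a].
rewrite inE eqxx => /(_ isT) ->; rewrite (lin_sum lf) big1 // => g _; exact: f0.
Qed.

(** For homogeneous [y] only the degree h - g can contribute. The difference may leave [Gamma],
    where [pi] vanishes, so no case distinction is needed. *)
Lemma pi_mul g h x y : pi h (pi g x * y) = pi g x * pi (h - g) y.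
Proof.
have mulA p q u v : pi p u = u -> pi q v = v -> pi (p + q) (u * v) = u * v.
  by have [_ [_ [_ [_ [_ [H _]]]]]] := bialgA; exact: (H p q u v).
apply/eqP; rewrite -subr_eq0; apply/eqP.
pose f y := pi h (pi g x * y) - pi g x * pi (h - g) y.
apply: (lin_homog_ext (f := f)) => [|q].
  apply: lin_add; first by apply: lin_pi; apply: lin_mull; apply: lin_id.
  by apply: lin_opp; apply: lin_mull; apply: lin_pi; apply: lin_id.
have e := mulA g q _ _ (pi_idem g x) (pi_idem q y).
rewrite /f; have [eq|ne] := eqVneq q (h - g).
  have gh : g + q = h by rewrite eq addrC subrK.
  by rewrite -eq pi_idem -{1}gh e subrr.
rewrite -e pi_orth; last first.
  by apply: contra ne => /eqP ->; rewrite [g + _]addrC addrK.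
by rewrite pi_orth 1?eq_sym // mulr0 subrr.
Qed.

Lemma pi_one : pi 0 1 = 1.
Proof. by have [_ [_ [_ [_ [_ [_ [h _]]]]]]] := bialgA; exact: h. Qed.

Lemma homog0 a : pi 0 a = a -> exists c : k, a = c%:A.
Proof. by have [_ [_ [_ [_ [_ [_ [_ [h _]]]]]]]] := bialgA; exact: h. Qed.

Lemma lin_eps : lin (eps : A -> k^o).
Proof. by have [_ [_ [_ [_ [_ [_ [_ [_ [h _]]]]]]]]] := bialgA; exact: h. Qed.

Lemma eps_one : eps 1 = 1.
Proof. by have [_ [_ [_ [_ [_ [_ [_ [_ [_ [_ [h _]]]]]]]]]]] := bialgA; exact: h. Qed.

Lemma eps_pi g a : g != 0 -> eps (pi g a) = 0.
Proof.
have [_ [_ [_ [_ [_ [_ [_ [_ [_ [_ [_ [h _]]]]]]]]]]]] := bialgA.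
by move=> g0; apply: (h g) => //; apply: pi_idem.
Qed.

(** Connectedness puts [pi 0 a] on the line of 1; applying [eps], which kills the other components,
    gives the coefficient. *)
Lemma pi0E a : pi 0 a = eps a *: 1.
Proof.
have [d ed] := homog0 (pi_idem 0 a); rewrite ed; congr (_ *: _).
have : eps a - eps (pi 0 a) = 0.
  apply: (lin_homog_ext (V := k^o) (f := fun a => eps a - eps (pi 0 a))) => [|g].
    apply: lin_add; first exact: lin_eps.
    by apply: lin_opp; apply: (lin_comp lin_eps); apply: lin_pi; apply: lin_id.
  have [->|g0] := eqVneq g 0; first by rewrite pi_idem subrr.
  by rewrite eps_pi // [pi 0 _]pi_orth 1?eq_sym // (lin0 lin_eps) subrr.
move/eqP; rewrite subr_eq0 => /eqP ->.
by rewrite ed (linZ lin_eps) eps_one /GRing.scale /= mulr1.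
Qed.

(** Sweedler's sum of F(a_1, a_2). For bilinear [F] it depends only on the tensor that the list
    [Delta a] represents. *)
Definition DD (V : lmodType k) (F : A -> A -> V) a : V :=
  \sum_(x <- Delta a) F x.1 x.2.

Lemma eq_DD (V : lmodType k) (F G : A -> A -> V) a :
  (forall u v, F u v = G u v) -> DD F a = DD G a.
Proof. by move=> h; apply: eq_bigr => i _; apply: h. Qed.

Lemma DD0 (V : lmodType k) (F : A -> A -> V) a :
  (forall u v, F u v = 0) -> DD F a = 0.
Proof. by move=> h; apply: big1 => i _; apply: h. Qed.

Lemma lin_DD (V : lmodType k) (F : A -> A -> V) : bilin F -> lin (DD F).
Proof.
have [_ [_ [_ [_ [_ [_ [_ [_ [_ [_ [_ [_ [h _]]]]]]]]]]]]] := bialgA.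
move=> bF d x y; rewrite /DD (teq2_bilin (h d x y) bF) big_cat big_map /=.
congr (_ + _); rewrite scaler_sumr; apply: eq_bigr => z _.
by have [Fl _] := bF; rewrite (linZ (Fl _)).
Qed.

Lemma lin_DDa (T V : lmodType k) (F : A -> A -> V) (f : T -> A) :
  bilin F -> lin f -> lin (fun t => DD F (f t)).
Proof. by move=> bF lf; apply: (lin_comp (lin_DD bF) lf). Qed.

Lemma lin_DDf (T V : lmodType k) (F : T -> A -> A -> V) a :
  (forall u v, lin (fun t => F t u v)) -> lin (fun t => DD (F t) a).
Proof. by move=> lF; apply: lin_big => z; apply: lF. Qed.

Lemma DD_lin (V W : lmodType k) (f : V -> W) (F : A -> A -> V) a :
  lin f -> f (DD F a) = DD (fun u v => f (F u v)) a.
Proof. by move=> lf; rewrite /DD (lin_sum lf). Qed.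

Lemma DD_exchange (V : lmodType k) (F : A -> A -> A -> A -> V) a x :
  DD (fun u v => DD (fun p q => F u v p q) x) a =
  DD (fun p q => DD (fun u v => F u v p q) a) x.
Proof. exact: exchange_big. Qed.

Lemma DD_mul (V : lmodType k) (F : A -> A -> V) x y : bilin F ->
  DD F (x * y) = DD (fun u v => DD (fun p q => F (u * p) (v * q)) y) x.
Proof.
have [_ [_ [_ [_ [_ [_ [_ [_ [_ [_ [_ [_ [_ [h _]]]]]]]]]]]]]] := bialgA.
by move=> bF; rewrite /DD (teq2_bilin (h x y) bF) big_allpairs_dep.
Qed.

Lemma DD_one (V : lmodType k) (F : A -> A -> V) : bilin F -> DD F 1 = F 1 1.
Proof.
have [_ [_ [_ [_ [_ [_ [_ [_ [_ [_ [_ [_ [_ [_ [h _]]]]]]]]]]]]]]] := bialgA.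
by move=> bF; rewrite /DD (teq2_bilin h bF) big_seq1.
Qed.

Lemma DD_homog (V : lmodType k) (F : A -> A -> V) g b c a : bilin F ->
  pi g a = a -> b + c != g -> DD (fun u v => F (pi b u) (pi c v)) a = 0.
Proof.
have [_ [_ [_ [_ [_ [_ [_ [_ [_ [_ [_ [_ [_ [_ [_ [h _]]]]]]]]]]]]]]]] := bialgA.
move=> bF ga ne; have := teq2_bilin (h _ _ _ _ ga ne) bF.
by rewrite big_map big_nil.
Qed.

Lemma DD_coassoc (V : lmodType k) (F : A -> A -> A -> V) a : trilin F ->
  DD (fun u v => DD (fun p q => F p q v) u) a =
  DD (fun u v => DD (fun p q => F u p q) v) a.
Proof.
have [_ [_ [_ [_ [_ [_ [_ [_ [_ [_ [_ [_ [_ [_ [_ [_ [h _]]]]]]]]]]]]]]]]] := bialgA.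
move=> tF; have := h a.
have E (J : A * A -> A) : forall K : A * A -> A * A -> {ffun 'I_3 -> A},
    [seq K i j | i <- Delta a, j <- Delta (J i)] =
    [seq K z.1 z.2 | z <- [seq (i, j) | i <- Delta a, j <- Delta (J i)]].
  by move=> K; rewrite map_allpairs.
rewrite (E fst) (E snd) => /teq3_trilin /(_ _ F tF).
by rewrite !big_allpairs_dep.
Qed.

Lemma counitl a : DD (fun u v => eps u *: v) a = a.
Proof.
have [_ [_ [_ [_ [_ [_ [_ [_ [_ [_ [_ [_ [_ [_ [_ [_ [_ [h _]]]]]]]]]]]]]]]]]] := bialgA.
exact: h.
Qed.

Lemma counitr a : DD (fun u v => eps v *: u) a = a.
Proof.
have [_ [_ [_ [_ [_ [_ [_ [_ [_ [_ [_ [_ [_ [_ [_ [_ [_ [_ h]]]]]]]]]]]]]]]]]] := bialgA.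
exact: h.
Qed.

(** Proves linearity in each variable by recursion on the shape of the map, using the linear,
    bilinear and trilinear hypotheses in context. *)
Ltac slin :=
  cbn beta;
  lazymatch goal with
  | |- bilin _ => split=> ?; slin
  | |- trilin _ => split=> ? ?; slin
  | |- forall _, _ => intro; slin
  | |- lin _ =>
    first
    [ assumption
    | exact: lin_id | exact: lin_eps | exact: lin_cst0
    | match goal with
      | H : lin _ |- _ => exact: H
      | H : bilin _ |- _ => exact: (proj1 H)
      | H : bilin _ |- _ => exact: (proj2 H)
      | H : lin _ |- _ => apply: (lin_comp H); slin
      | H : bilin _ |- _ => apply: (bilin_l _ H); slin
      | H : bilin _ |- _ => apply: (bilin_r _ H); slin
      | H : trilin _ |- _ => apply: (trilin_1 _ _ H); slin
      | H : trilin _ |- _ => apply: (trilin_2 _ _ H); slin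
      | H : trilin _ |- _ => apply: (trilin_3 _ _ H); slin
      end
    | apply: lin_pi; slin
    | apply: lin_opp; slin
    | apply: lin_add; slin
    | apply: lin_mull; slin
    | apply: lin_mulr; slin
    | apply: (lin_comp lin_eps); slin
    | apply: lin_scaler; slin
    | apply: lin_scalel; slin
    | apply: lin_DDf; slin
    | apply: lin_DDa; slin ]
  end.

Lemma DD_extl (V : lmodType k) (F : A -> A -> V) a : bilin F ->
  (forall g, DD (fun u v => F (pi g u) v) a = 0) -> DD F a = 0.
Proof.
move=> bF F0; have [D [_ _ eD]] := pi_decompose (map fst (Delta a)).
rewrite /DD (eq_big_seq (fun z => \sum_(g <- D) F (pi g z.1) z.2)).
  by rewrite exchange_big big1 // => g _; apply: F0.
move=> z za; rewrite {1}(eD z.1 (map_f _ za)).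
by rewrite (lin_sum (proj1 bF _)).
Qed.

Lemma DD_extr (V : lmodType k) (F : A -> A -> V) a : bilin F ->
  (forall g, DD (fun u v => F u (pi g v)) a = 0) -> DD F a = 0.
Proof.
move=> bF F0; have [D [_ _ eD]] := pi_decompose (map snd (Delta a)).
rewrite /DD (eq_big_seq (fun z => \sum_(g <- D) F z.1 (pi g z.2))).
  by rewrite exchange_big big1 // => g _; apply: F0.
move=> z za; rewrite {1}(eD z.2 (map_f _ za)).
by rewrite (lin_sum (proj2 bF _)).
Qed.

Lemma DDB (V : lmodType k) (F G : A -> A -> V) a :
  DD (fun u v => F u v - G u v) a = DD F a - DD G a.
Proof. by rewrite /DD sumrB. Qed.

(** The difference of the two sides is tested on each left degree separately. *)
Lemma DD_single_l (V : lmodType k) (F : A -> A -> V) a b : bilin F ->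
  (forall g, g != b -> DD (fun u v => F (pi g u) v) a = 0) ->
  DD F a = DD (fun u v => F (pi b u) v) a.
Proof.
move=> bF F0; apply/eqP; rewrite -subr_eq0 -DDB; apply/eqP.
apply: DD_extl => [|g]; first by slin.
rewrite DDB; have [->|ne] := eqVneq g b.
  by apply/eqP; rewrite subr_eq0; apply/eqP; apply: eq_DD => u v; rewrite pi_idem.
rewrite F0 // sub0r DD0 ?oppr0 // => u v.
by rewrite pi_orth 1?eq_sym // (lin0 (proj1 bF _)).
Qed.

Lemma DD_single_r (V : lmodType k) (F : A -> A -> V) a b : bilin F ->
  (forall g, g != b -> DD (fun u v => F u (pi g v)) a = 0) ->
  DD F a = DD (fun u v => F u (pi b v)) a.
Proof.
move=> bF F0; apply/eqP; rewrite -subr_eq0 -DDB; apply/eqP.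
apply: DD_extr => [|g]; first by slin.
rewrite DDB; have [->|ne] := eqVneq g b.
  by apply/eqP; rewrite subr_eq0; apply/eqP; apply: eq_DD => u v; rewrite pi_idem.
rewrite F0 // sub0r DD0 ?oppr0 // => u v.
by rewrite pi_orth 1?eq_sym // (lin0 (proj2 bF _)).
Qed.

(** The coproduct preserves total degree, so fixing the left degree fixes the right one. *)
Lemma DD_homog_l (V : lmodType k) (F : A -> A -> V) g b a : bilin F -> pi g a = a ->
  DD (fun u v => F (pi b u) v) a = DD (fun u v => F (pi b u) (pi (g - b) v)) a.
Proof.
move=> bF ga; apply: DD_single_r => [|h hb]; first by slin.
by apply: (DD_homog bF ga); apply: contra hb => /eqP <-; rewrite [b + h]addrC addrK.
Qed.

Lemma DD_homog_r (V : lmodType k) (F : A -> A -> V) g b a : bilin F -> pi g a = a ->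
  DD (fun u v => F u (pi b v)) a = DD (fun u v => F (pi (g - b) u) (pi b v)) a.
Proof.
move=> bF ga; apply: DD_single_l => [|h hb]; first by slin.
by apply: (DD_homog bF ga); apply: contra hb => /eqP <-; rewrite addrK.
Qed.

(** Since [pi 0] is the counit times 1, this is the counit axiom: the component of left degree 0 is
    1 (x) a. *)
Lemma DD_pi0_l (V : lmodType k) (F : A -> A -> V) a : bilin F ->
  DD (fun u v => F (pi 0 u) v) a = F 1 a.
Proof.
move=> bF; rewrite -{2}(counitl a) (DD_lin _ _ (proj2 bF 1)); apply: eq_DD => u v.
by rewrite pi0E (linZ (proj1 bF _)) (linZ (proj2 bF _)).
Qed.

Lemma DD_pi0_r (V : lmodType k) (F : A -> A -> V) a : bilin F ->
  DD (fun u v => F u (pi 0 v)) a = F a 1.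
Proof.
move=> bF; rewrite -{2}(counitr a) (DD_lin _ _ (proj1 bF 1)); apply: eq_DD => u v.
by rewrite pi0E (linZ (proj1 bF _)) (linZ (proj2 bF _)).
Qed.

(* b is not in L(a) *)
Definition lvan b a : Prop := forall (V : lmodType k) (F : A -> A -> V),
  bilin F -> DD (fun u v => F (pi b u) v) a = 0.

Definition rvan b a : Prop := forall (V : lmodType k) (F : A -> A -> V),
  bilin F -> DD (fun u v => F u (pi b v)) a = 0.

Lemma lvan_lset b a : lvan b a -> ~ Lset pi Delta a b.
Proof.
move=> va [c]; apply=> f mf; rewrite /tcomp -map_comp big_map big_nil.
have bf := multilinear_t2 mf.
have bF : bilin (fun u v => f (t2 (u, pi c v)) : k^o).
  split=> [y|x]; first exact: (proj1 bf).
  by apply: (bilin_r _ bf); slin.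
exact: (va k^o _ bF).
Qed.

Lemma lset_lvan b a : ~ Lset pi Delta a b -> lvan b a.
Proof.
move=> nL V F bF; apply: DD_extr => [|c]; first by slin.
have h : teq2 (tcomp pi b c (Delta a)) [::].
  by apply: contrapT => ne; apply: nL; exists c.
by have := teq2_bilin h bF; rewrite big_map big_nil.
Qed.

Lemma lvan_lin b d x y : lvan b x -> lvan b y -> lvan b (d *: x + y).
Proof.
move=> vx vy V F bF.
have bG : bilin (fun u v => F (pi b u) v) by slin.
by rewrite (lin_DD bG) vx // vy // scaler0 addr0.
Qed.

Lemma lvan0 b : lvan b 0.
Proof.
move=> V F bF.
have bG : bilin (fun u v => F (pi b u) v) by slin.
by rewrite (lin0 (lin_DD bG)).
Qed.

Lemma lvan_out b a : ~ Gamma b -> lvan b a.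
Proof.
by move=> nG V F bF; apply: DD0 => u v; rewrite pi_out // (lin0 (proj1 bF _)).
Qed.

Lemma lvan_out_r g b a : pi g a = a -> ~ Gamma (g - b) -> lvan b a.
Proof.
move=> ga nG V F bF; rewrite (DD_homog_l _ bF ga).
by apply: DD0 => u v; rewrite (pi_out _ nG) (lin0 (proj2 bF _)).
Qed.

(** The component of the coproduct in A^g (x) A^0 is a (x) 1, so a nonzero homogeneous element has
    its own degree in its L-set. *)
Lemma lvan_degree g a : pi g a = a -> lvan g a -> a = 0.
Proof.
move=> ga va; have bF : bilin (fun u v : A => eps v *: u) by slin.
have := va _ _ bF;
  rewrite (DD_homog_l _ bF ga) subrr (DD_pi0_r (F := fun u v : A => eps v *: pi g u)); last by slin.
by rewrite ga eps_one scale1r.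
Qed.

Lemma lvan_one b : b != 0 -> lvan b 1.
Proof.
move=> b0 V F bF; rewrite DD_one; last by slin.
by rewrite -pi_one pi_orth // (lin0 (proj1 bF _)).
Qed.

Lemma DD_mul_extl (V : lmodType k) (F : A -> A -> V) b h x y : bilin F ->
  lvan h x \/ lvan (b - h) y ->
  DD (fun u v => DD (fun p q => F (pi b (pi h u * p)) (v * q)) y) x = 0.
Proof.
move=> bF [vx|vy].
  by apply: (vx _ (fun u v => DD (fun p q => F (pi b (u * p)) (v * q)) y)); slin.
apply: DD0 => u v; under eq_DD do rewrite pi_mul.
by apply: (vy _ (fun p q => F (pi h u * p) (v * q))); slin.
Qed.

(** Multiplicativity of the coproduct, in contrapositive form: L(xy) is contained in L(x) + L(y). *)
Lemma lvan_mul b x y : (forall h, lvan h x \/ lvan (b - h) y) -> lvan b (x * y).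
Proof.
move=> vxy V F bF; rewrite DD_mul; last by slin.
by apply: DD_extl => [|h]; [slin | apply: DD_mul_extl].
Qed.

(** When [b] can only arise as b + 0, the factor [y] enters through its component 1 (x) y alone. *)
Lemma DD_mul_single (V : lmodType k) (F : A -> A -> V) b x y : bilin F ->
  (forall h, h != b -> lvan h x \/ lvan (b - h) y) ->
  DD (fun u v => F (pi b u) v) (x * y) = DD (fun u v => F (pi b u) (v * y)) x.
Proof.
move=> bF vxy; rewrite DD_mul; last by slin.
rewrite (@DD_single_l _ _ _ b); last first.
- by move=> h hb; apply: DD_mul_extl => //; apply: vxy.
- by slin.
apply: eq_DD => u v; under eq_DD do rewrite pi_mul subrr.
rewrite (DD_pi0_l (F := fun p q => F (pi b u * p) (v * q))); last by slin.
by rewrite mulr1.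
Qed.

(** * Slope bounds and the leading component of a product *)

Definition slopes_le mu x : Prop := forall b, 0 < ell mu b -> lvan b x.
(** Degree 0 must be excluded explicitly: it carries the component 1 (x) x, and [ell mu 0] is 0. In
    [slopes_le] the strict inequality already excludes it. *)
Definition slopes_lt mu x : Prop := forall b, b != 0 -> 0 <= ell mu b -> lvan b x.

Lemma slopes_mul_pos mu x y b : slopes_le mu x -> slopes_lt mu y ->
  0 < ell mu b -> lvan b (x * y).
Proof.
move=> vx vy b0; apply: lvan_mul => h.
have [h0|h0] := ltP 0 (ell mu h); [by left; apply: vx | right].
have lt : 0 < ell mu (b - h) by rewrite ellB; lra.
apply: vy; last exact: ltW.
by apply/eqP => e; move: lt; rewrite e; case: (mu) => [m|] /=; lra.
Qed.

Lemma DD_slopes_mul (V : lmodType k) (F : A -> A -> V) mu x y b : bilin F ->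
  slopes_le mu x -> slopes_lt mu y -> ell mu b = 0 ->
  DD (fun u v => F (pi b u) v) (x * y) = DD (fun u v => F (pi b u) (v * y)) x.
Proof.
move=> bF vx vy b0; apply: DD_mul_single => // h hb.
have [h0|h0] := ltP 0 (ell mu h); [by left; apply: vx | right].
apply: vy; first by rewrite subr_eq0 eq_sym.
by rewrite ellB; lra.
Qed.

(* On the ray of slope mu only the leading term x (x) y survives. *)
Lemma DD_slopes_mul_homog (V : lmodType k) (F : A -> A -> V) mu x y b g : bilin F ->
  pi g x = x -> slopes_le mu x -> slopes_lt mu y -> ell mu b = 0 ->
  (b = g \/ ~ half_plane (g - b)) ->
  DD (fun u v => F (pi b u) v) (x * y) = F (pi b x) y.
Proof.
move=> bF gx vx vy b0 hb; rewrite (DD_slopes_mul bF vx vy b0).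
case: hb => [bg|nh].
  rewrite (DD_homog_l (F := fun u v => F u (v * y)) b _ gx); last by slin.
  rewrite bg subrr (DD_pi0_r (F := fun u v => F (pi g u) (v * y))); last by slin.
  by rewrite mul1r.
(* Both sides vanish: [x] has no component of left degree [b], and [pi b x] is 0 because [b] differs
   from [g]. *)
have nG : ~ Gamma (g - b) by move=> /Gamma_half_plane.
rewrite (lvan_out_r gx nG (F := fun u v => F u (v * y))); last by slin.
rewrite -gx pi_orth ?(lin0 (proj1 bF _)) //.
by apply/eqP => bg; apply: nh; rewrite bg subrr; right.
Qed.

Lemma slopes_lt_mul mu x y : slopes_lt mu x -> slopes_lt mu y -> slopes_lt mu (x * y).
Proof.
move=> vx vy b b0 eb; apply: lvan_mul => h.
have [->|h0] := eqVneq h 0; first by right; apply: vy; rewrite ?subr0.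
have [lh|lh] := leP 0 (ell mu h); [by left; apply: vx | right].
have lt : 0 < ell mu (b - h) by rewrite ellB; lra.
apply: vy; last exact: ltW.
by apply/eqP => e; move: lt; rewrite e; case: (mu) => [m|] /=; lra.
Qed.

Lemma slopes_lt_one mu : slopes_lt mu 1.
Proof. by move=> b b0 _; apply: lvan_one. Qed.

(** * Injectivity *)

Lemma semistable_slopes_le mu a : semistable Gamma pi Delta mu a -> slopes_le mu a.
Proof.
move=> [g [_ _ La]] b b0; apply: lset_lvan => /La Lb.
have Gb : Gamma b by case: Lb => nu [_ []].
have := (Gamma_leP mu Gb (Gamma_half_plane Gb)).1 Lb; lra.
Qed.

(** The spanning semistable elements are homogeneous, so a projection keeps or kills each of
    them. *)
Lemma in_Amu_pi mu x : in_Amu Gamma pi Delta mu x ->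
  forall g, slopes_le mu (pi g x) /\ (ell mu g != 0 -> pi g x = 0).
Proof.
have lp g : lin (pi g) by exact: lin_pi (@lin_id _ _).
move=> [s [ss ->]] g; elim: s ss => [|z s IH] ss.
  by rewrite big_nil (lin0 (lp g)); split=> // b _; apply: lvan0.
have [|IH1 IH2] := IH; first by move=> y ys; apply: ss; rewrite inE ys orbT.
have sz : semistable Gamma pi Delta mu z.2 by apply: ss; rewrite inE eqxx.
rewrite big_cons (lp g); split=> [b b0|g0].
  apply: lvan_lin; last exact: IH1.
  have [h [hz _ _]] := sz; have [<-|gh] := eqVneq h g.
    by rewrite hz; apply: semistable_slopes_le sz _ b0.
  by rewrite -hz pi_orth 1?eq_sym //; apply: lvan0.
rewrite IH2 // addr0; have [h [hz hG _]] := sz.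
rewrite -hz pi_orth ?scaler0 //; apply: contra g0 => /eqP ->.
by apply/eqP; exact: (proj1 (Gamma_slope_ell _ _ _) hG).2.
Qed.

Lemma in_Amu_slopes_le mu x : in_Amu Gamma pi Delta mu x -> slopes_le mu x.
Proof.
move=> [s [ss ->]] b b0; elim: s ss => [|z s IH] ss.
  by rewrite big_nil; apply: lvan0.
rewrite big_cons; apply: lvan_lin.
  by apply: semistable_slopes_le b0; apply: ss; rewrite inE eqxx.
by apply: IH => y ys; apply: ss; rewrite inE ys orbT.
Qed.

Lemma slopes_le_lt nu mu x : slope_lt nu mu -> slopes_le nu x -> slopes_lt mu x.
Proof.
move=> lt sx b b0 eb; have [Gb|] := pselect (Gamma b); last exact: lvan_out.
apply: sx; rewrite ltNge; apply/negP => le.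
have := ell_lt lt (Gamma_half_plane Gb) b0 le; lra.
Qed.

(* Multiplication is injective on A_[mu] (x) A_{<mu}: the component of the
   coproduct in the largest degree g1 of the left factors recovers the part of
   the tensor whose left factor has degree g1. *)
Lemma slopes_tensor_inj mu (s : seq (A * A)) :
  (forall z, z \in s -> forall g,
     slopes_le mu (pi g z.1) /\ (ell mu g != 0 -> pi g z.1 = 0)) ->
  (forall z, z \in s -> slopes_lt mu z.2) ->
  \sum_(z <- s) z.1 * z.2 = 0 ->
  forall (V : lmodType k) (F : A -> A -> V), bilin F ->
    \sum_(z <- s) F z.1 z.2 = 0.
Proof.
have lp g : lin (pi g) by exact: lin_pi (@lin_id _ _).
have [D [_ oD _]] := pi_decompose (map fst s).
have {}oD z : z \in s -> forall g, g \notin D -> pi g z.1 = 0.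
  by move=> zs g; apply: oD; apply: map_f.
(* Induction on the number of degrees that may occur in the left factors. *)
have [n] := ubnP (size D); elim: n D s oD => // n IH D s oD leD s1 s2 s0 V F bF.
have [D0|D0] := eqVneq D [::].
  rewrite big_seq big1 // => z zs; rewrite (_ : z.1 = 0) ?(lin0 (proj1 bF _)) //.
  apply: (lin_homog_ext (f := fun x => x)) => [|g]; first exact: lin_id.
  by apply: oD; rewrite ?D0.
have [||//|g1 g1D g1max] := @exists_max _ (fun b c : R * R => half_plane (c - b)) D.
- by move=> b c d h h'; have := half_planeD h' h; rewrite addrA subrK.
- by move=> b c; case: (half_plane_total b c) => h; [right|left].
have key (W : lmodType k) (G : A -> A -> W) : bilin G ->
    \sum_(z <- s) G (pi g1 z.1) z.2 = 0.
  move=> bG; have [e1|e1] := eqVneq (ell mu g1) 0; last first.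
    rewrite big_seq big1 // => z zs; have [_ ->] := s1 _ zs g1 => //.
    exact: (lin0 (proj1 bG _)).
  have bG' : bilin (fun u v => G (pi g1 u) v) by slin.
  (* Take the component of left degree [g1] in the coproduct of the relation. By maximality of [g1],
     the other homogeneous parts of the left factors contribute nothing to it. *)
  have := lin0 (lin_DD bG'); rewrite -{1}s0 (lin_sum (lin_DD bG')) => s0'.
  rewrite -[RHS]s0'.
  apply: eq_big_seq => z zs; apply/eqP; rewrite -subr_eq0; apply/eqP.
  apply: (lin_homog_ext (f := fun x =>
     G (pi g1 x) z.2 - DD (fun u v => G (pi g1 u) v) (x * z.2))) => [|g].
    by slin.
  have [gD|gD] := boolP (g \in D); last first.
    rewrite (oD z zs g gD) mul0r (lin0 (lin_DD bG')) (lin0 (lp _)).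
    by rewrite (lin0 (proj1 bG _)) subrr.
  rewrite (DD_slopes_mul_homog (mu := mu) bG (pi_idem g z.1)) ?subrr //.
  - exact: (s1 _ zs g).1.
  - exact: s2.
  - have [hp|] := pselect (half_plane (g - g1)); [left | by right].
    have := half_plane_antisym hp; rewrite opprB => /(_ (g1max _ gD)) /eqP.
    by rewrite subr_eq0 => /eqP ->.
have bM : bilin (fun u v : A => u * v).
  by split=> y; [apply: lin_mulr | apply: lin_mull]; apply: lin_id.
(* By [key] for the multiplication map, deleting the parts of degree [g1] preserves the relation. *)
pose s' := [seq (z.1 - pi g1 z.1, z.2) | z <- s].
pose D' := [seq g <- D | g != g1].
have piB g x : pi g (x - pi g1 x) = if g == g1 then 0 else pi g x.
  rewrite (linB (lp g)); have [->|ne] := eqVneq g g1; first by rewrite pi_idem subrr.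
  by rewrite pi_orth // subr0.
have : \sum_(z <- s') F z.1 z.2 = 0.
  apply: (IH D') => //.
  - move=> z /mapP [y ys ->] g /=; rewrite piB mem_filter negb_and negbK.
    by case: eqP => // _ /=; apply: oD.
  - rewrite size_filter -ltnS; apply: leq_trans leD; rewrite ltnS.
    rewrite -(count_predC (pred1 g1) D) -[X in (X < _)%N]add0n.
    by rewrite ltn_add2r -has_count has_pred1.
  - move=> z /mapP [y ys ->] g /=; rewrite piB.
    case: eqP => _; last exact: (s1 _ ys g).
    by split=> // b _; apply: lvan0.
  - by move=> z /mapP [y ys ->]; exact: (s2 _ ys).
  - rewrite big_map /=; under eq_bigr do rewrite mulrBl.
    by rewrite sumrB s0 (key _ _ bM) subrr.
rewrite big_map /=; under eq_bigr do rewrite (linB (proj1 bF _)).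
by rewrite sumrB key // subr0.
Qed.

(** * Pure tensors split into head and tail *)

Definition ffun_cons p (x : A) (v : {ffun 'I_p -> A}) : {ffun 'I_p.+1 -> A} :=
  [ffun i => if unlift ord0 i is Some j then v j else x].

Lemma ffun_consE p (u : {ffun 'I_p.+1 -> A}) :
  u = ffun_cons (u ord0) [ffun i => u (lift ord0 i)].
Proof.
by apply/ffunP => i; rewrite ffunE; case: unliftP => [j|] ->; rewrite ?ffunE.
Qed.

Lemma multilinear_tail p (f : {ffun 'I_p.+1 -> A} -> k) x :
  multilinear f -> multilinear (fun v => f (ffun_cons x v)).
Proof.
move=> mf u i c y z.
have E w : ffun_cons x (upd u i w) = upd (ffun_cons x u) (lift ord0 i) w.
  apply/ffunP => j; rewrite !ffunE; case: unliftP => [j'|] ->; rewrite ?ffunE.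
    by rewrite (inj_eq (@lift_inj _ _)).
  by rewrite (negbTE (neq_lift _ _)).
by rewrite !E mf.
Qed.

Lemma multilinear_head p (f : {ffun 'I_p.+1 -> A} -> k^o) v :
  multilinear f -> lin (fun x => f (ffun_cons x v)).
Proof.
move=> mf c y z.
have E w : ffun_cons w v = upd (ffun_cons 0 v) ord0 w.
  apply/ffunP => j; rewrite !ffunE; case: unliftP => [j'|] ej.
    by case: eqP => // e; rewrite e in ej; have := neq_lift ord0 j'; rewrite -ej eqxx.
  by rewrite ej eqxx.
by rewrite (E (_ + _)) mf -!E.
Qed.

(** Induction peels off the largest slope. Explicit coefficients store the scalars left when the
    first factor is contracted, even in 0-fold tensors, where no factor could absorb them. *)
Lemma mult_injective (ms : seq (option R)) : decreasing_slopes ms ->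
  forall s : seq (k * {ffun 'I_(size ms) -> A}),
    (forall z, z \in s -> forall i : 'I_(size ms), in_Amu Gamma pi Delta (nth None ms i) (z.2 i)) ->
    \sum_(z <- s) z.1 *: \prod_i z.2 i = 0 ->
    forall f : {ffun 'I_(size ms) -> A} -> k, multilinear f ->
      \sum_(z <- s) z.1 * f z.2 = 0.
Proof.
elim: ms => [|mu ms IH] dec s sA s0 f mf.
  have E (u : {ffun 'I_0 -> A}) : u = [ffun=> 0] by apply/ffunP => -[].
  have : \sum_(z <- s) z.1 = 0.
    move: s0; under eq_bigr do rewrite big_ord0.
    by rewrite -scaler_suml => /eqP; rewrite scaler_eq0 oner_eq0 orbF => /eqP.
  under [X in _ -> X = 0]eq_bigr do rewrite (E _.2).
  by rewrite -mulr_suml => ->; rewrite mul0r.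
have decms : decreasing_slopes ms by exact: path_sorted dec.
have ltms : all (fun nu => slope_lt nu mu) ms.
  by apply: order_path_min dec => x y z h h'; apply: slope_lt_trans h.
pose tl (u : {ffun 'I_(size ms).+1 -> A}) : {ffun 'I_(size ms) -> A} :=
  [ffun i => u (lift ord0 i)].
pose hd (u : {ffun 'I_(size ms).+1 -> A}) := u ord0.
pose t := [seq (hd z.2, z.1 *: \prod_i tl z.2 i) | z <- s].
have tinj (V : lmodType k) (F : A -> A -> V) : bilin F ->
    \sum_(z <- t) F z.1 z.2 = 0.
  apply: (slopes_tensor_inj (mu := mu)).
  - by move=> z /mapP [y ys ->]; apply: in_Amu_pi; apply: (sA y ys ord0).
  - move=> z /mapP [y ys ->] /= b b0 eb; rewrite -[_ *: _]addr0.
    apply: lvan_lin; last exact: lvan0.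
    apply: (big_ind (slopes_lt mu)) b b0 eb => [||i _].
    + exact: slopes_lt_one.
    + exact: slopes_lt_mul.
    + rewrite ffunE; apply: (slopes_le_lt (nu := nth None ms i)).
        by apply: (allP ltms); apply: mem_nth.
      by apply: in_Amu_slopes_le; apply: (sA y ys (lift ord0 i)).
  - rewrite big_map /= -[RHS]s0; apply: eq_bigr => z _.
    rewrite -scalerAr [in RHS]big_ord_recl /=; congr (_ *: (_ * _)).
    by apply: eq_bigr => i _; rewrite ffunE.
(* Heads are expanded in the [e i]. Contracting the vanishing tensor [t] by [phi i] gives a relation
   between products of tails, to which the induction hypothesis applies. *)
have [n [phi [e [lphi _ eX]]]] := finite_rank_projector [seq hd z.2 | z <- s].
have lf v := multilinear_head (f := f) v mf.
rewrite (eq_big_seq (fun z => \sum_(i < n)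
    (z.1 * phi i (hd z.2)) * f (ffun_cons (e i) (tl z.2)))); last first.
  move=> z zs; rewrite {1}(ffun_consE z.2) -/(hd z.2) {1}(eX (hd z.2));
    last by apply/mapP; exists z.
  rewrite (lin_sum (lf _)) mulr_sumr; apply: eq_bigr => i _.
  by rewrite (linZ (lf _)) mulrA.
rewrite exchange_big /= big1 // => i _.
have := IH decms [seq (z.1 * phi i (hd z.2), tl z.2) | z <- s] _ _
  (fun v => f (ffun_cons (e i) v)) (multilinear_tail (e i) mf).
rewrite !big_map /=; apply.
  move=> z /mapP [y ys ->] j /=; rewrite ffunE.
  exact: (sA y ys (lift ord0 j)).
have bF : bilin (fun u v : A => phi i u *: v) by have := lphi i; slin.
have := tinj _ _ bF; rewrite big_map /= => tF; rewrite -[RHS]tF.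
by apply: eq_bigr => z _; rewrite scalerA mulrC.
Qed.

(** * Surjectivity *)

Definition mvan g a : Prop := forall (V : lmodType k) (F : A -> A -> A -> V),
  trilin F -> DD (fun u v => DD (fun p q => F p (pi g q) v) u) a = 0.

(* Since outer legs can be contracted into the middle one, bounding the degrees
   of the middle leg alone defines a sub-bialgebra when S is a submonoid. *)
Definition middle_in (S : R * R -> Prop) a : Prop := forall g, ~ S g -> mvan g a.

(** The counit applied to the first leg turns the middle leg of the iterated coproduct into a left
    leg. *)
Lemma mvan_lvan g a : mvan g a -> lvan g a.
Proof.
move=> va V F bF.
have tG : trilin (fun p q v => eps p *: F q v) by slin.
rewrite -[RHS](va _ _ tG); apply: eq_DD => u v.
rewrite -{1}(counitl u) (DD_lin (f := fun x => F (pi g x) v)); last by slin.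
by apply: eq_DD => p q; rewrite piZ (linZ (proj1 bF _)).
Qed.

Lemma mvan_rvan g a : mvan g a -> rvan g a.
Proof.
move=> va V F bF.
have tG : trilin (fun p q v => eps v *: F p q) by slin.
have bH : bilin (fun u v => F u (pi g v)) by slin.
rewrite -[RHS](va _ _ tG) -{1}(counitr a) (DD_lin _ _ (lin_DD bH)).
apply: eq_DD => u v; rewrite (linZ (lin_DD bH)).
by rewrite (DD_lin _ _ (lin_scaler _ (@lin_id _ _))).
Qed.

Lemma middle_in_lin S d x y :
  middle_in S x -> middle_in S y -> middle_in S (d *: x + y).
Proof.
move=> hx hy g nS V F tF.
have bG : bilin (fun u v => DD (fun p q => F p (pi g q) v) u) by slin.
by rewrite (lin_DD bG) hx // hy // scaler0 addr0.
Qed.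

Lemma middle_in0 S : middle_in S 0.
Proof.
move=> g nS V F tF.
have bG : bilin (fun u v => DD (fun p q => F p (pi g q) v) u) by slin.
by rewrite (lin0 (lin_DD bG)).
Qed.

Lemma middle_in_lvan S b a : middle_in S a -> ~ S b -> lvan b a.
Proof. by move=> ha /ha /mvan_lvan. Qed.

Lemma middle_in_lvan_r S g b a : pi g a = a -> middle_in S a -> ~ S (g - b) -> lvan b a.
Proof.
move=> ga ha /ha /mvan_rvan ra V F bF; rewrite (DD_homog_l _ bF ga).
by apply: (ra _ (fun u v => F (pi b u) v)); slin.
Qed.

Lemma middle_in_mul S x y : (forall b c, S b -> S c -> S (b + c)) ->
  middle_in S x -> middle_in S y -> middle_in S (x * y).
Proof.
move=> SD hx hy g nS V F tF.
have bG : bilin (fun u v => DD (fun p q => F p (pi g q) v) u) by slin.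
rewrite (DD_mul _ _ bG).
pose G p q v := DD (fun u' v' => DD (fun p' q' =>
  F (p * p') (pi g (q * q')) (v * v')) u') y.
have tG : trilin G by rewrite /G; slin.
transitivity (DD (fun u v => DD (fun p q => G p q v) u) x).
  apply: eq_DD => u v; rewrite /G.
  rewrite [RHS]DD_exchange; apply: eq_DD => u' v'.
  by rewrite DD_mul //; slin.
(* Split the middle legs of [x] by degree h. Either h is outside [S] and [x] gives 0, or g - h is
   outside [S] by additivity and [y] gives 0. *)
have [D [_ _ eD]] := pi_decompose [seq j.2 | i <- Delta x, j <- Delta i.1].
rewrite {1}/DD.
transitivity (\sum_(h <- D) DD (fun u v => DD (fun p q => G p (pi h q) v) u) x).
  rewrite /DD [RHS]exchange_big /=; apply: eq_big_seq => i ix.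
  rewrite [RHS]exchange_big /=; apply: eq_big_seq => j ji.
  rewrite {1}(eD j.2); last by apply/allpairsPdep; exists i, j.
  have lG : lin (fun q => G j.1 q i.2) by slin.
  by rewrite (lin_sum lG).
apply: big1 => h _; have [Sh|nSh] := pselect (S h); last exact: hx.
apply: DD0 => u v; apply: DD0 => p q; rewrite /G.
have nSg : ~ S (g - h).
  by move=> Sg; apply: nS; rewrite -(subrK h g); apply: SD.
under eq_DD do under eq_DD do rewrite pi_mul.
by apply: (hy _ nSg _ (fun p' q' v' => F (p * p') (pi h q * q') (v * v'))); slin.
Qed.

(** Middle legs of the contraction are second legs of the fourfold coproduct; coassociativity merges
    the last two legs into one outer leg. *)
Lemma middle_in_contract_r S (psi : A -> k^o) a : lin psi -> middle_in S a ->
  middle_in S (DD (fun u v => psi v *: u) a).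
Proof.
move=> lpsi ha g nS V F tF.
have bH : bilin (fun u v => DD (fun p q => F p (pi g q) v) u) by slin.
rewrite (DD_lin _ _ (lin_DD bH)).
pose H u v w := DD (fun p q => psi w *: F p (pi g q) v) u.
have tH : trilin H by rewrite /H; slin.
transitivity (DD (fun u w => DD (fun p q => H p q w) u) a).
  apply: eq_DD => u w; rewrite (linZ (lin_DD bH)).
  rewrite (DD_lin _ _ (lin_scaler _ (@lin_id _ _))); apply: eq_DD => p q.
  by rewrite (DD_lin _ _ (lin_scaler _ (@lin_id _ _))).
rewrite (DD_coassoc _ tH) -[RHS](ha _ nS V (fun p q w =>
  DD (fun v w' => psi w' *: F p q v) w)); last by slin.
by apply: eq_DD => u w; rewrite /H DD_exchange.
Qed.

(** Here the third of four legs is constrained, and the first two are merged. *)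
Lemma middle_in_contract_l S (phi : A -> k^o) a : lin phi -> middle_in S a ->
  middle_in S (DD (fun u v => phi u *: v) a).
Proof.
move=> lphi ha g nS V F tF.
have bH : bilin (fun u v => DD (fun p q => F p (pi g q) v) u) by slin.
rewrite (DD_lin _ _ (lin_DD bH)).
pose H w u v := phi w *: DD (fun p q => F p (pi g q) v) u.
have tH : trilin H by rewrite /H; slin.
transitivity (DD (fun w u => DD (fun p q => H w p q) u) a).
  apply: eq_DD => w u; rewrite (linZ (lin_DD bH)).
  by rewrite (DD_lin _ _ (lin_scaler _ (@lin_id _ _))).
rewrite -(DD_coassoc _ tH) -[RHS](ha _ nS V (fun u0 q v =>
  DD (fun w p => phi w *: F p q v) u0)); last by slin.
apply: eq_DD => z v.
rewrite (DD_coassoc (F := fun w p q => phi w *: F p (pi g q) v)); last by slin.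
by apply: eq_DD => w u; rewrite /H (DD_lin _ _ (lin_scaler _ (@lin_id _ _))).
Qed.

Lemma lvan_contract_r b (psi : A -> k^o) a : lin psi -> lvan b a ->
  lvan b (DD (fun u v => psi v *: u) a).
Proof.
move=> lpsi ha V F bF.
have bH : bilin (fun u v => F (pi b u) v) by slin.
rewrite (DD_lin _ _ (lin_DD bH)).
transitivity (DD (fun u w => DD (fun p q => psi w *: F (pi b p) q) u) a).
  apply: eq_DD => u w; rewrite (linZ (lin_DD bH)).
  by rewrite (DD_lin _ _ (lin_scaler _ (@lin_id _ _))).
rewrite (DD_coassoc (F := fun p q w => psi w *: F (pi b p) q)); last by slin.
by apply: (ha _ (fun u v => DD (fun p q => psi q *: F u p) v)); slin.
Qed.

(** By coassociativity, the contracted leg of degree [c] and the next leg of degree [b] come from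
    one left leg of [a], of degree c + b. *)
Lemma lvan_contract_l b c (phi : A -> k^o) a : lin phi -> lvan (c + b) a ->
  lvan b (DD (fun u v => phi (pi c u) *: v) a).
Proof.
move=> lphi ha V F bF.
have bH : bilin (fun u v => F (pi b u) v) by slin.
rewrite (DD_lin _ _ (lin_DD bH)).
transitivity (DD (fun w u => DD (fun p q => phi (pi c w) *: F (pi b p) q) u) a).
  apply: eq_DD => w u; rewrite (linZ (lin_DD bH)).
  by rewrite (DD_lin _ _ (lin_scaler _ (@lin_id _ _))).
rewrite -(DD_coassoc (F := fun w p q => phi (pi c w) *: F (pi b p) q)); last by slin.
pose G u v := DD (fun p q => phi (pi c p) *: F (pi b q) v) u.
have bG : bilin G by rewrite /G; slin.
rewrite -/(DD G a) (@DD_single_l _ _ _ (c + b) bG) ?ha // => g gcb.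
apply: DD0 => u v; rewrite /G.
apply: (DD_homog (F := fun p q => phi p *: F q v) _ (pi_idem g u)); first by slin.
by rewrite eq_sym.
Qed.

(** * Finitely generated submonoids of the half-plane *)

Inductive gen (D : seq (R * R)) : R * R -> Prop :=
| gen0 : gen D 0
| genS d b : d \in D -> gen D b -> gen D (d + b).

Lemma gen_add D b c : gen D b -> gen D c -> gen D (b + c).
Proof.
move=> hb hc; elim: hb => [|d b' dD _ IH]; first by rewrite add0r.
by rewrite -addrA; apply: genS.
Qed.

(** Generators are added one at a time. If d.1 > 0, raising [p] suffices and lowers no other value;
    if [d] is on the vertical axis, the whole form is scaled up. *)
Lemma half_plane_weight (D : seq (R * R)) :
  (forall d, d \in D -> half_plane d /\ d != 0) ->
  exists p q : R, [/\ 0 <= p, 0 < q & forall d, d \in D -> 1 <= p * d.1 + q * d.2].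
Proof.
elim: D => [|d D IH] hD; first by exists 0, 1; split.
have [|p [q [p0 q0 hpq]]] := IH; first by move=> e eD; apply: hD; rewrite inE eD orbT.
have hD1 e : e \in D -> 0 <= e.1.
  by move=> eD; have [|[h|[-> _]] _] := hD e; rewrite ?inE ?eD ?orbT //; exact: ltW.
have [|hd d0] := hD d; first by rewrite inE eqxx.
case: hd => [hd|[hd1 hd2]].
  exists (p + `|1 - p * d.1 - q * d.2| / d.1), q; split=> //.
    by rewrite addr_ge0 // divr_ge0 // ltW.
  move=> e; rewrite inE => /orP [/eqP ->|eD].
    rewrite mulrDl mulfVK ?gt_eqF //.
    have := ler_norm (1 - p * d.1 - q * d.2); lra.
  rewrite mulrDl; have := hpq e eD.
  have : 0 <= `|1 - p * d.1 - q * d.2| / d.1 * e.1.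
    by rewrite mulr_ge0 ?hD1 // divr_ge0 // ltW.
  lra.
have {}hd2 : 0 < d.2 by rewrite lt_def hd2 andbT pair_neq0.
have qd : 0 < q * d.2 by apply: mulr_gt0.
pose t := 1 + (q * d.2)^-1.
have t1 : 1 <= t by rewrite /t lerDl invr_ge0 ltW.
exists (t * p), (t * q); split; [nra | nra |].
move=> e; rewrite inE => /orP [/eqP ->|eD].
  rewrite hd1 mulr0 add0r -mulrA /t mulrDl mulVf ?gt_eqF //; lra.
have := hpq e eD; rewrite -!mulrA -mulrDr; nra.
Qed.

Lemma gen_weight D (p q : R) : (forall d, d \in D -> 1 <= p * d.1 + q * d.2) ->
  forall b, gen D b -> b = 0 \/ 1 <= p * b.1 + q * b.2.
Proof.
move=> hD b; elim=> [|d b' dD _ IH]; [by left | right].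
have := hD d dD; case: IH => [->|]; first by rewrite addr0.
by rewrite /=; lra.
Qed.

(** Each generator costs at least 1, so an element of weight at most n is a sum of at most n
    generators. *)
Lemma gen_finite D (p q : R) : (forall d, d \in D -> 1 <= p * d.1 + q * d.2) ->
  forall n, exists E : seq (R * R),
    forall b, gen D b -> p * b.1 + q * b.2 <= n%:R -> b \in E.
Proof.
move=> hD; elim=> [|n [E hE]].
  exists [:: 0] => b hb; rewrite inE; case: (gen_weight hD hb) => [->//|].
  by move=> h h'; exfalso; move: h'; rewrite mulr0n; lra.
exists (0 :: [seq d + b | d <- D, b <- E]) => b; case=> [|d b' dD hb].
  by rewrite inE eqxx.
move=> le; rewrite inE; apply/orP; right; apply/allpairsP; exists (d, b'); split=> //=.
apply: hE => //; move: le; rewrite /= -natr1; have := hD d dD; lra.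
Qed.

(** The representative of the iterated coproduct is finite, so finitely many degrees occur in its
    middle legs; the nonzero ones generate. *)
Lemma middle_in_finite a : exists D : seq (R * R),
  (forall d, d \in D -> half_plane d /\ d != 0) /\ middle_in (gen D) a.
Proof.
have [D [_ oD _]] := pi_decompose [seq j.2 | i <- Delta a, j <- Delta i.1].
exists [seq d <- D | `[< half_plane d >] && (d != 0)]; split.
  by move=> d; rewrite mem_filter => /andP [/andP [/asboolP]].
move=> g nS V F tF; rewrite {1}/DD big_seq big1 // => i ia.
rewrite /DD big_seq big1 // => j ji.
have pj : pi g j.2 = 0; last first.
  have lF : lin (fun q => F j.1 q i.2) by slin.
  by rewrite pj (lin0 lF).
have [Gg|/pi_out -> //] := pselect (Gamma g).
apply: oD; first by apply/allpairsPdep; exists i, j.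
apply/negP => gD; apply: nS; rewrite -[g]addr0.
have [->|g0] := eqVneq g 0; first by rewrite addr0; apply: gen0.
apply: genS; last exact: gen0.
by rewrite mem_filter gD g0 !andbT; apply/asboolP; apply: Gamma_half_plane.
Qed.

(* Sums of products a_1 ... a_p of semistable elements with decreasing slopes,
   all of them in Q. *)
Inductive hn : (option R -> Prop) -> A -> Prop :=
| hn_scalar Q (d : k) : hn Q d%:A
| hn_lin Q (d : k) x y : hn Q x -> hn Q y -> hn Q (d *: x + y)
| hn_mul Q mu x y : Q mu -> semistable Gamma pi Delta mu x ->
    hn (fun nu => slope_lt nu mu) y -> hn Q (x * y).

Lemma hn0 Q : hn Q 0.
Proof. by rewrite -(scale0r 1); apply: hn_scalar. Qed.

Lemma hn_sum Q n (F : nat -> A) : (forall i, hn Q (F i)) -> hn Q (\sum_(i < n) F i).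
Proof.
move=> hF; elim: n => [|n IH]; first by rewrite big_ord0; apply: hn0.
by rewrite big_ord_recr /= addrC -[F n]scale1r; apply: hn_lin.
Qed.

Lemma ell_gt0 mu b : half_plane b -> b != 0 -> slope_lt mu (slp b) -> 0 < ell mu b.
Proof.
move=> hb b0 lt; rewrite lt_def leNgt -slp_ltP //; apply/andP; split.
  apply/eqP => /(slp_eqP mu hb b0) e; by rewrite e slope_lt_irr in lt.
by apply/negP => lt'; have := slope_lt_trans lt lt'; rewrite slope_lt_irr.
Qed.

Section Surjectivity.
Variables (D : seq (R * R)) (p q : R).
Hypothesis D_weight : forall d, d \in D -> 1 <= p * d.1 + q * d.2.
Let weight b := p * b.1 + q * b.2.
Let S := gen D.

Let weightB b c : weight (b - c) = weight b - weight c.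
Proof. by rewrite /weight /=; ring. Qed.

Let S_ge0 b : S b -> 0 <= weight b.
Proof.
move=> /(gen_weight D_weight) [->|]; last by rewrite /weight; lra.
by rewrite /weight /=; lra.
Qed.

(* The leading part of the coproduct of a: b1 is maximal in L(a) for the order
   by slope, then lexicographic on each ray. *)
Lemma split_top g a b1 : pi g a = a -> middle_in S a -> Gamma b1 -> b1 != 0 ->
  (forall b, b != 0 -> ~ slope_lex_le b b1 -> lvan b a) ->
  exists n (xs ys : nat -> A),
    [/\ forall (V : lmodType k) (F : A -> A -> V), bilin F ->
          DD (fun u v => F (pi b1 u) v) a = \sum_(i < n) F (xs i) (ys i),
        forall i, [/\ pi b1 (xs i) = xs i, middle_in S (xs i),
           slopes_le (slp b1) (xs i) & semistable Gamma pi Delta (slp b1) (xs i)] &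
        forall i, [/\ pi (g - b1) (ys i) = ys i, middle_in S (ys i) &
           slopes_lt (slp b1) (ys i)]].
Proof.
move=> ga Sa Gb1 b10 topa; set h := g - b1; set mu := slp b1.
have hp1 := Gamma_half_plane Gb1.
have eb1 : ell mu b1 = 0 by exact: ell_slp.
have gh : g - h = b1 by rewrite /h opprB addrC subrK.
pose t := [seq (pi b1 z.1, pi h z.2) | z <- Delta a].
have [n [xs [ys [tE xsE ysE]]]] := minimal_tensor_representative t.
have xs_contract i : exists2 psi : A -> k^o, lin psi &
    xs i = DD (fun u v => psi v *: u) a.
  have [psi lpsi ->] := xsE i; exists (fun v => psi (pi h v)); first by slin.
  rewrite big_map (DD_homog_r (F := fun u v => psi v *: u) h _ ga); last by slin.
  by rewrite gh.
have ys_contract i : exists2 phi : A -> k^o, lin phi &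
    ys i = DD (fun u v => phi (pi b1 u) *: v) a.
  have [phi lphi ->] := ysE i; exists phi => //.
  by rewrite big_map (DD_homog_l (F := fun u v => phi u *: v) b1 _ ga); last by slin.
have pi_sum c r (G : A * A -> k) (H : A * A -> A) : (forall z, pi c (H z) = H z) ->
    pi c (\sum_(z <- r) G z *: H z) = \sum_(z <- r) G z *: H z.
  move=> hH; rewrite (lin_sum (lin_pi c (@lin_id _ _))).
  by apply: eq_bigr => z _; rewrite piZ hH.
have xs_le i : slopes_le mu (xs i).
  move=> b b0; have [Gb|] := pselect (Gamma b); last exact: lvan_out.
  have [psi lpsi ->] := xs_contract i; apply: lvan_contract_r => //.
  have bn0 : b != 0.
    by apply/eqP => e; move: b0; rewrite e; case: (mu) => [m|] /=; lra.
  apply: topa => // -[|[e _]].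
    by rewrite (slp_ltP _ (Gamma_half_plane Gb) bn0) -/mu; lra.
  by move: b0; rewrite /mu -e ell_slp ltxx.
exists n, xs, ys; split.
- move=> V F bF; rewrite (DD_homog_l _ bF ga) -(tE _ _ bF).
  by rewrite /t big_map.
- move=> i; have hx : pi b1 (xs i) = xs i.
    by have [psi _ ->] := xsE i; rewrite big_map; apply: pi_sum => z; apply: pi_idem.
  split=> //; first by have [psi lpsi ->] := xs_contract i; apply: middle_in_contract_r.
  exists b1; split=> //; first by apply/Gamma_slope_ell.
  move=> b Lb; have [Gb|/lvan_out nG] := pselect (Gamma b); last first.
    by have := lvan_lset (nG (xs i)) Lb.
  apply/(Gamma_leP mu Gb (Gamma_half_plane Gb)); rewrite leNgt; apply/negP => lt.
  exact: lvan_lset (xs_le i b lt) Lb.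
- move=> i; split.
  + by have [phi _ ->] := ysE i; rewrite big_map; apply: pi_sum => z; apply: pi_idem.
  + have [phi lphi ->] := ys_contract i.
    by apply: (middle_in_contract_l (phi := fun u => phi (pi b1 u))); first slin.
  (* Such a [b] in L(ys i) would put b1 + b in L(a), of larger slope than [b1] or beyond it on the
     same ray, against the choice of [b1]. *)
  + move=> b b0 eb; have [Gb|] := pselect (Gamma b); last exact: lvan_out.
    have hb := Gamma_half_plane Gb.
    have [phi lphi ->] := ys_contract i; apply: lvan_contract_l => //.
    have b1b0 : b1 + b != 0.
      apply: contra b10 => /eqP e; rewrite (half_plane_antisym hp1) //.
      by rewrite -[- b1]addr0 -e addKr.
    apply: topa => // -[|[_]].
      by rewrite (slp_ltP _ (half_planeD hp1 hb) b1b0) ellD -/mu; lra.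
    rewrite opprD addNKr => hNb.
    by move: b0; rewrite (half_plane_antisym hb hNb) eqxx.
Qed.

(** Two nested inductions. The outer one, on a bound for the weight of [g], serves the right factors
    from [split_top], whose weight is smaller by at least 1. The inner one strikes off the largest
    candidate for L(a). *)
Lemma hn_homog n : forall g a (Q : option R -> Prop),
  (forall mu nu, slope_lt nu mu -> Q mu -> Q nu) ->
  pi g a = a -> middle_in S a -> weight g < n%:R ->
  (forall b, b != 0 -> ~ Q (slp b) -> lvan b a) -> hn Q a.
Proof.
elim: n => [|n IHn] g a Q Qdown ga Sa gn Qa.
  (* A negative weight puts [g] outside [S], hence a = 0. *)
  rewrite (@lvan_degree g a) //; first exact: hn0.
  apply: (middle_in_lvan Sa) => /S_ge0; move: gn; rewrite mulr0n; lra.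
(* If [b] and g - b lie in [S], the weight of [b] is at most that of [g]; hence [E] contains all
   candidates for L(a). *)
have [E hE] := gen_finite D_weight n.+1.
(* The list [bs] holds all nonzero candidates and is closed downwards, so the smaller degrees
   created by a subtraction are already in it. *)
suff inner m : forall (bs : seq (R * R)) a, (size bs < m)%N -> 0 \notin bs ->
    (forall b b', b' \in bs -> b != 0 -> S b -> S (g - b) ->
       slope_lex_le b b' -> b \in bs) ->
    pi g a = a -> middle_in S a -> (forall b, b != 0 -> ~ Q (slp b) -> lvan b a) ->
    (forall b, b != 0 -> b \notin bs -> lvan b a) -> hn Q a.
  have inE b : b != 0 -> S b -> S (g - b) -> b \in [seq b <- E | b != 0].
    move=> b0 Sb Sgb; rewrite mem_filter b0; apply: hE => //.
    have := S_ge0 Sgb; rewrite weightB /weight in gn *; lra.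
  apply: (inner _ [seq b <- E | b != 0] a (leqnn _)) => //.
  - by rewrite mem_filter eqxx.
  - by move=> b b' _ b0 Sb Sgb _; apply: inE.
  - move=> b b0 bE; have [Sb|] := pselect (S b); last exact: middle_in_lvan.
    have [Sgb|] := pselect (S (g - b)); last exact: middle_in_lvan_r.
    by move: bE; rewrite inE.
elim: m => // m IHm bs {}a szbs bs0 down {}ga {}Sa {}Qa bsa.
(* With no candidate left, either [g] is 0 and [a] is a scalar, or [a] vanishes. *)
have [bsnil|bsn] := eqVneq bs [::].
  have [g0|g0] := eqVneq g 0.
    by have [|d ->] := @homog0 a; [rewrite -g0 | apply: hn_scalar].
  by rewrite (@lvan_degree g a) //; [apply: hn0 | apply: bsa => //; rewrite bsnil].
have [b1 b1bs b1max] := exists_max (@slope_lex_le_trans R) (@slope_lex_le_total R) bsn.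
have b10 : b1 != 0 by apply: contra bs0 => /eqP <-.
pose bs' := [seq b <- bs | b != b1].
have szbs' : (size bs' < m)%N.
  rewrite -ltnS; apply: leq_trans szbs; rewrite ltnS size_filter.
  rewrite -(count_predC (pred1 b1) bs) -[X in (X < _)%N]add0n.
  by rewrite ltn_add2r -has_count has_pred1.
have bs'0 : 0 \notin bs' by rewrite mem_filter (negbTE bs0) andbF.
have down' b b' : b' \in bs' -> b != 0 -> S b -> S (g - b) ->
    slope_lex_le b b' -> b \in bs'.
  rewrite !mem_filter => /andP [b'1 b'bs] b0 Sb Sgb le; rewrite (down b b') // andbT.
  apply: contra b'1 => /eqP e; rewrite e in le.
  by apply/eqP; apply: slope_lex_le_antisym le; apply: b1max.
have [va|nva] := pselect (lvan b1 a).
  apply: (IHm bs') => // b b0; rewrite mem_filter negb_and negbK.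
  by case/orP => [/eqP ->|] //; apply: bsa.
have Gb1 : Gamma b1 by apply: contrapT => /lvan_out; apply: (contra_not _ nva).
have Sb1 : S b1 by apply: contrapT => /(middle_in_lvan Sa).
have Sgb1 : S (g - b1) by apply: contrapT => /(middle_in_lvan_r ga Sa).
have Qb1 : Q (slp b1) by apply: contrapT => /(Qa _ b10).
have hp1 := Gamma_half_plane Gb1.
have topa b : b != 0 -> ~ slope_lex_le b b1 -> lvan b a.
  by move=> b0 nle; apply: bsa => //; apply/negP => /b1max.
have [r [xs [ys [tE xsP ysP]]]] := split_top ga Sa Gb1 b10 topa.
pose z i := xs i * ys i.
have hn_ys i : hn (fun nu => slope_lt nu (slp b1)) (ys i).
  have [hy Sy lty] := ysP i; apply: IHn hy Sy _ _.
  - by move=> mu nu lt lt'; apply: slope_lt_trans lt'.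
  - rewrite weightB; have := gen_weight D_weight Sb1.
    case=> [e|]; first by rewrite e eqxx in b10.
    by move: gn; rewrite -natr1 /weight; lra.
  - move=> b b0 /negP nlt; have [Gb|] := pselect (Gamma b); last exact: lvan_out.
    apply: lty => //; rewrite leNgt -slp_ltP //; exact: Gamma_half_plane.
have hn_z i : hn Q (z i) by apply: hn_mul (hn_ys i) => //; have [] := xsP i.
have z_pos i b : half_plane b -> b != 0 -> slope_lt (slp b1) (slp b) -> lvan b (z i).
  move=> hb b0 lt; have [_ _ lex _] := xsP i; have [_ _ lty] := ysP i.
  by apply: slopes_mul_pos lex lty _; apply: ell_gt0.
have z_ray i b (V : lmodType k) (F : A -> A -> V) : bilin F -> ell (slp b1) b = 0 ->
    b = b1 \/ ~ half_plane (b1 - b) ->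
    DD (fun u v => F (pi b u) v) (z i) = F (pi b (xs i)) (ys i).
  move=> bF eb hb; have [hx _ lex _] := xsP i; have [_ _ lty] := ysP i.
  exact: DD_slopes_mul_homog hx lex lty eb hb.
pose y := \sum_(i < r) z i.
have lvan_y b : (forall i, lvan b (z i)) -> lvan b y.
  move=> vz; apply: (big_ind (lvan b)) => // [|u v vu vv]; first exact: lvan0.
  by rewrite -[u]scale1r; apply: lvan_lin.
have lvan_ay b : lvan b a -> lvan b y -> lvan b (a - y).
  by move=> vu vv; rewrite addrC -scaleN1r; apply: lvan_lin.
have Sz i : middle_in S (z i).
  have [_ Sx _ _] := xsP i; have [_ Sy _] := ysP i.
  by apply: middle_in_mul Sx Sy; apply: gen_add.
have Say : middle_in S (a - y).
  rewrite addrC -scaleN1r; apply: middle_in_lin => //.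
  apply: (big_ind (middle_in S)) => // [|u v vu vv]; first exact: middle_in0.
  by rewrite -[u]scale1r; apply: middle_in_lin.
have gay : pi g (a - y) = a - y.
  have lp := lin_pi g (@lin_id _ A); rewrite (linB lp) ga (lin_sum lp); congr (_ - _).
  apply: eq_bigr => i _; have [hx _ _ _] := xsP i; have [hy _ _] := ysP i.
  by rewrite /z -hx pi_mul hy hx.
have -> : a = 1 *: y + (a - y) by rewrite scale1r addrC subrK.
apply: hn_lin; first exact: hn_sum.
apply: (IHm bs') => //.
  move=> b b0 nQ; apply: lvan_ay; first exact: Qa.
  apply: lvan_y => i; have [Gb|] := pselect (Gamma b); last exact: lvan_out.
  apply: z_pos => //; first exact: Gamma_half_plane.
  have [lt|e|//] := slope_lt_total (slp b) (slp b1).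
    by case: nQ; apply: Qdown Qb1.
  by case: nQ; rewrite e.
move=> b b0; rewrite mem_filter negb_and negbK => bbs'.
(* At [b1] both [a] and [y] have the component given by the sum of the xs i (x) ys i. *)
have [->|bb1] := eqVneq b b1.
  move=> V F bF; have bG : bilin (fun u v => F (pi b1 u) v) by slin.
  rewrite (linB (lin_DD bG)) (tE _ _ bF) (lin_sum (lin_DD bG)); apply/eqP.
  rewrite subr_eq0; apply/eqP; apply: eq_bigr => i _.
  rewrite z_ray //; first by have [-> _ _ _] := xsP i.
    exact: ell_slp.
  by left.
rewrite (negbTE bb1) /= in bbs'.
have [Gb|] := pselect (Gamma b); last exact: lvan_out.
have [Sb|] := pselect (S b); last exact: middle_in_lvan.
have [Sgb|] := pselect (S (g - b)); last exact: middle_in_lvan_r.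
have hb := Gamma_half_plane Gb.
(* Any remaining [b] lies strictly above [b1], where neither [a] nor the products [z i] have a
   component. *)
have nle : ~ slope_lex_le b b1 by move=> le; move: bbs'; rewrite (down b b1).
apply: lvan_ay; first exact: topa.
apply: lvan_y => i; have [lt|e|lt] := slope_lt_total (slp b) (slp b1).
- by case: nle; left.
- move=> V F bF; rewrite z_ray //.
  + have [<- _ _ _] := xsP i.
    by rewrite pi_orth // (lin0 (proj1 bF _)).
  + by rewrite -e ell_slp.
  + by right => h; apply: nle; right.
- exact: z_pos.
Qed.

End Surjectivity.

Lemma hn_all a : hn (fun _ => True) a.
Proof.
have [s [us _ es]] := pi_decompose [:: a].
rewrite (es a (mem_head _ _)); apply: (big_ind (hn _)) => [|x y hx hy|g _].
- exact: hn0.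
- by rewrite -[x]scale1r; apply: hn_lin.
have [D [hD mD]] := middle_in_finite (pi g a).
have [p [q [_ _ hpq]]] := half_plane_weight hD.
apply: (hn_homog hpq (n := Num.bound `|p * g.1 + q * g.2|) (g := g)) => //.
- exact: pi_idem.
- exact: le_lt_trans (ler_norm _) (archi_boundP (normr_ge0 _)).
Qed.

(** * From sums of ordered products to the tensor product *)

Fixpoint fits (ms : seq (option R)) (w : seq A) : Prop :=
  match ms, w with
  | [::], [::] => True
  | mu :: ms, x :: w => in_Amu Gamma pi Delta mu x /\ fits ms w
  | _, _ => False
  end.

Lemma fits_cat ms1 w1 ms2 w2 :
  fits ms1 w1 -> fits ms2 w2 -> fits (ms1 ++ ms2) (w1 ++ w2).
Proof.
by elim: ms1 w1 => [|mu ms1 IH] [|x w1] //= [hx hw] h2; split=> //; apply: IH.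
Qed.

Lemma fits_size ms w : fits ms w -> size w = size ms.
Proof. by elim: ms w => [|mu ms IH] [|x w] //= [_ /IH ->]. Qed.

Lemma fits_nth ms w : fits ms w -> forall i, (i < size ms)%N ->
  in_Amu Gamma pi Delta (nth None ms i) (nth 0 w i).
Proof. by elim: ms w => [|mu ms IH] [|x w] //= [hx hw] [|i] //= /(IH _ hw). Qed.

Lemma semistable_in_Amu mu x :
  semistable Gamma pi Delta mu x -> in_Amu Gamma pi Delta mu x.
Proof.
move=> sx; exists [:: (1, x)]; rewrite big_seq1 scale1r; split=> // y.
by rewrite inE => /eqP ->.
Qed.

Lemma in_AmuZ mu (d : k) x :
  in_Amu Gamma pi Delta mu x -> in_Amu Gamma pi Delta mu (d *: x).
Proof.
move=> [s [ss ->]]; exists [seq (d * z.1, z.2) | z <- s]; split.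
  by move=> z /mapP [z' z's ->] /=; apply: ss.
by rewrite scaler_sumr big_map; apply: eq_bigr => z _; rewrite scalerA.
Qed.

(** Degree 0 lies on every ray, so 1 is semistable of every slope and can pad missing factors. *)
Lemma in_Amu1 mu : Gamma 0 -> in_Amu Gamma pi Delta mu 1.
Proof.
move=> G0; apply: semistable_in_Amu; exists 0; split.
- exact: pi_one.
- by split=> //; case: mu => //= m; rewrite mulr0.
move=> b Lb; have [->|b0] := eqVneq b 0; last first.
  by have := lvan_lset (lvan_one b0) Lb.
apply/Gamma_leP => //; first exact: Gamma_half_plane.
by case: mu => [m|] /=; lra.
Qed.

Lemma fits_nseq1 ms : Gamma 0 -> fits ms (nseq (size ms) 1).
Proof. by move=> G0; elim: ms => //= mu ms IH; split=> //; apply: in_Amu1. Qed.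

Lemma prod_nseq1 n : \prod_(x <- nseq n (1 : A)) x = 1.
Proof. by rewrite big_seq big1 // => x /nseqP []. Qed.

Lemma decreasing_slopesE (ms : seq (option R)) :
  decreasing_slopes ms = pairwise (fun mu nu => slope_lt nu mu) ms.
Proof. by apply: sorted_pairwise => x y z h h'; apply: slope_lt_trans h. Qed.

Definition tensor_rep (ms : seq (option R)) a : Prop :=
  exists s : seq (k * seq A), (forall z, z \in s -> fits ms z.2) /\
    a = \sum_(z <- s) z.1 *: \prod_(x <- z.2) x.

(** Allowing every larger list [ms'] puts the two terms of a linear combination on a common list. *)
Lemma hn_tensor_rep Q a : Gamma 0 -> hn Q a ->
  (forall mu nu, slope_lt nu mu -> Q mu -> Q nu) -> exists ms : seq (option R),
  (forall nu, nu \in ms -> Q nu) /\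
  forall ms', decreasing_slopes ms' -> {subset ms <= ms'} -> tensor_rep ms' a.
Proof.
move=> G0; elim=> {Q a} [Q d _|Q d x y _ IH1 _ IH2 down|Q mu x y Qmu sx _ IH down].
- exists [::]; split=> // ms' _ _; exists [:: (d, nseq (size ms') 1)]; split.
    by move=> z; rewrite inE => /eqP ->; apply: fits_nseq1.
  by rewrite big_seq1 prod_nseq1.
- have [ms1 [Q1 h1]] := IH1 down; have [ms2 [Q2 h2]] := IH2 down.
  exists (ms1 ++ ms2); split=> [nu|ms' dec sub].
    by rewrite mem_cat => /orP [/Q1|/Q2].
  have [|s1 [f1 ->]] := h1 ms' dec.
    by move=> nu h; apply: sub; rewrite mem_cat h.
  have [|s2 [f2 ->]] := h2 ms' dec.
    by move=> nu h; apply: sub; rewrite mem_cat h orbT.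
  exists ([seq (d * z.1, z.2) | z <- s1] ++ s2); split.
    by move=> z; rewrite mem_cat => /orP [/mapP [z' /f1 h ->]|/f2].
  rewrite big_cat big_map scaler_sumr; congr (_ + _).
  by apply: eq_bigr => z _; rewrite scalerA.
- have [|ms [ltms hms]] := IH.
    by move=> nu nu' lt lt'; apply: slope_lt_trans lt'.
  exists (mu :: ms); split=> [nu|ms' dec sub].
    by rewrite inE => /orP [/eqP ->|/ltms lt] //; apply: down Qmu.
  have mums' : mu \in ms' by apply: sub; rewrite mem_head.
  (* The slopes in [pre] exceed [mu], so those needed for the right factor all lie in [post]; the
     positions in [pre] are filled with 1. *)
  case/splitPr: mums' dec sub => pre post.
  rewrite decreasing_slopesE pairwise_cat /= => /and3P [rel _ /andP [lt dec]] sub.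
  have [||s [fs ->]] := hms post; first by rewrite decreasing_slopesE.
    move=> nu nums; have := sub nu; rewrite inE nums orbT => /(_ isT).
    have ltnu := ltms _ nums.
    rewrite mem_cat inE => /or3P [nupre|/eqP e|//].
      have := allrelP rel _ _ nupre (mem_head mu post) => ltmu.
      by have := slope_lt_trans ltnu ltmu; rewrite slope_lt_irr.
    by move: ltnu; rewrite e slope_lt_irr.
  exists [seq (z.1, nseq (size pre) 1 ++ x :: z.2) | z <- s]; split.
    move=> z /mapP [z' /fs fz ->]; apply: fits_cat; first exact: fits_nseq1.
    by split=> //; apply: semistable_in_Amu.
  rewrite big_map mulr_sumr; apply: eq_bigr => z _ /=.
  by rewrite big_cat /= prod_nseq1 mul1r big_cons scalerAr.
Qed.

Lemma decreasing_insert mu (ms : seq (option R)) : decreasing_slopes ms ->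
  exists ms', decreasing_slopes ms' /\ {subset mu :: ms <= ms'}.
Proof.
move=> dec; exists ([seq nu <- ms | slope_lt mu nu] ++
  mu :: [seq nu <- ms | slope_lt nu mu]); split.
  move: dec; rewrite !decreasing_slopesE => dec.
  rewrite pairwise_cat /= !pairwise_filter // !filter_all !andbT.
  apply/allrelP => nu nu'; rewrite mem_filter => /andP [lt _].
  rewrite inE mem_filter => /orP [/eqP -> //|/andP [lt' _]].
  exact: slope_lt_trans lt.
move=> nu; rewrite inE mem_cat inE !mem_filter => /orP [->|->]; first by rewrite orbT.
by rewrite !andbT; have [->|->|->] := slope_lt_total nu mu; rewrite ?eqxx ?orbT.
Qed.

Lemma decreasing_cover (ms : seq (option R)) :
  exists ms', decreasing_slopes ms' /\ {subset ms <= ms'}.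
Proof.
elim: ms => [|mu ms [ms' [dec sub]]]; first by exists [::].
have [ms'' [dec' sub']] := decreasing_insert mu dec; exists ms''; split=> // nu.
rewrite inE => /orP [/eqP ->|/sub h]; apply: sub'; first by rewrite mem_head.
by rewrite inE h orbT.
Qed.

Lemma mult_surjective a : Gamma 0 -> exists ms : seq (option R), decreasing_slopes ms /\
  exists2 s, @in_tensor_Amu R k A Gamma pi Delta ms s & a = mult_map s.
Proof.
move=> G0; have [|ms0 [_ h]] := hn_tensor_rep G0 (hn_all a) => //.
(* Adding the slope infinity makes the list nonempty, so a first factor exists to absorb the
   coefficients. *)
have [ms [dec sub]] := decreasing_cover (None :: ms0).
exists ms; split=> //.
have [|s [fs ->]] := h ms dec.
  by move=> nu hnu; apply: sub; rewrite inE hnu orbT.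
have sz : (0 < size ms)%N by case: (ms) (sub None (mem_head _ _)).
pose scale_head (z : k * seq A) := z.1 *: head 0 z.2 :: behead z.2.
have fits_scale z : z \in s -> fits ms (scale_head z).
  move=> /fs; rewrite /scale_head; case: (ms) sz => // mu ms' _.
  by case: z.2 => //= x w [hx hw]; split=> //; apply: in_AmuZ.
exists [seq [ffun i : 'I_(size ms) => nth 0 (scale_head z) i] | z <- s].
  by move=> u /mapP [z zs ->] i; rewrite ffunE; apply: fits_nth => //; apply: fits_scale.
rewrite /mult_map big_map; apply: eq_big_seq => z zs.
under [RHS]eq_bigr do rewrite ffunE.
rewrite -(big_mkord xpredT (fun i => nth 0 (scale_head z) i)).
rewrite -(fits_size (fits_scale z zs)) -(big_nth 0 xpredT id).
have := fits_size (fs z zs); rewrite /scale_head.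
case: z.2 => [|x w] /= szw; first by rewrite -szw in sz.
by rewrite !big_cons scalerAl.
Qed.

End GradedBialgebra.

Theorem theorem2p5 (R : realType) (k : fieldType) (A : algType k)
  (Gamma : R * R -> Prop) (pi : R * R -> A -> A) (eps : A -> k)
  (Delta : A -> seq (A * A)) :
  discrete_submonoid_half_plane Gamma ->
  is_Gamma_graded_connected_bialgebra Gamma pi eps Delta ->
  mult_bijective Gamma pi Delta.
Proof.
move=> [G0 _ Ghp _] bA; split=> [ms dec s sA s0 f mf|a].
  have fE : \sum_(u <- s) f u = \sum_(z <- [seq (1, u) | u <- s]) z.1 * f z.2.
    by rewrite big_map; apply: eq_bigr => u _; rewrite mul1r.
  rewrite fE big_nil; apply: (mult_injective Ghp bA dec) mf.
    by move=> z /mapP [u us ->] i; apply: sA.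
  rewrite big_map -[RHS]s0; apply: eq_bigr => u _.
  by rewrite scale1r.
exact: (mult_surjective Ghp bA).
Qed.
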